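(* Let $\Omega\subset\mathbb{R}^2$ be open and bounded with piecewise-smooth boundary $\Gamma$, and let $S=\{(x_i,y_i)\}_{i=1}^n$ be a node set with $n\ge \eta_p=(p+1)(p+2)/2$. Let $V\in\mathbb{R}^{n\times\eta_p}$ be the generalized Vandermonde matrix with columns $V_{:,k}=\mathbf{p}_k$, $k=1,\dots,\eta_p$, and assume the columns of $V$ are linearly independent. Then there exists a cubature rule on $\Omega$ with nodes $S$, positive weights, and degree at least $2p-1$ (exact for all polynomials of total degree at most $2p-1$) if and only if there exist degree $p$ diagonal-norm SBP operators approximating $\partial/\partial x$ and $\partial/\partial y$ on the node set $S$.
   Context: Monomial basis: for $j\in\{0,\dots,p\}$ and $i\in\{0,\dots,j\}$ set $\mathcal{P}_k(x,y)=x^{i}y^{j-i}$ with $k=j(j+1)/2+i+1$; thus $\mathcal{P}_1,\dots,\mathcal{P}_{\eta_p}$ are the monomials of total degree at most $p$, where $\eta_p=(p+1)(p+2)/2$. $\mathbf{p}_k$ denotes the vector of values of $\mathcal{P}_k$ at the nodes of $S$. Definition (SBP operator): an $n\times n$ matrix $D_x$ is a degree $p$ SBP approximation of $\partial/\partial x$ on $S$ (for $\Omega$ with outward unit normal $(n_x,n_y)$ on $\Gamma$) if (1) $D_x\mathbf{p}_k=\mathbf{p}_k'$ for all $k\le\eta_p$, where $\mathbf{p}_k'$ is the vector of values of $\partial\mathcal{P}_k/\partial x$ at the nodes; (2) $D_x=H^{-1}Q_x$ with $H$ symmetric positive definite; (3) $Q_x=Q_x^A+\tfrac12E_x$ with $(Q_x^A)^T=-Q_x^A$,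 $E_x^T=E_x$, and $\mathbf{p}_k^TE_x\mathbf{p}_m=\oint_\Gamma \mathcal{P}_k\mathcal{P}_m n_x\,d\Gamma$ for all $k,m\le\eta_\tau$, for some integer $\tau\ge p$. The analogous definition for $\partial/\partial y$ replaces $\partial\mathcal{P}_k/\partial x$ by $\partial\mathcal{P}_k/\partial y$ and $n_x$ by $n_y$ (with matrices $D_y,Q_y,Q_y^A,E_y$). The operator is diagonal-norm if $H$ is diagonal. *)

(* Defs.v *)
From HB Require Import structures.
From mathcomp Require Import all_boot all_order all_algebra.
From mathcomp Require Import all_classical all_reals all_analysis.
Set Implicit Arguments. Unset Strict Implicit. Unset Printing Implicit Defensive.
Import Order.TTheory GRing.Theory Num.Theory.
Import numFieldNormedType.Exports.
Local Open Scope classical_set_scope.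
Local Open Scope ring_scope.

(* eta_p = (p+1)(p+2)/2 : number of monomials of total degree <= p *)
Definition etap (p : nat) : nat := ((p.+1 * p.+2)./2)%N.

(* Decoding of the (0-based) index k = j(j+1)/2 + i  (paper's 1-based k-1):
   the monomial P_{k+1} = x^i y^(j-i). *)
Definition mon_deg (k : nat) : nat := count (fun j => etap j <= k)%N (iota 0 k.+1).
Definition mon_exp (k : nat) : nat * nat :=
  let j := mon_deg k in let i := (k - (j * j.+1)./2)%N in (i, (j - i)%N).

Section Defs.
Variable R : realType.

Definition mono (k : nat) (z : R * R) : R :=
  z.1 ^+ (mon_exp k).1 * z.2 ^+ (mon_exp k).2.
Definition mono_dx (k : nat) (z : R * R) : R :=
  ((mon_exp k).1)%:R * z.1 ^+ (mon_exp k).1.-1 * z.2 ^+ (mon_exp k).2.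
Definition mono_dy (k : nat) (z : R * R) : R :=
  ((mon_exp k).2)%:R * z.1 ^+ (mon_exp k).1 * z.2 ^+ (mon_exp k).2.-1.

Definition nodevec n (S : 'I_n -> R * R) (f : R * R -> R) : 'cV[R]_n :=
  \col_i f (S i).

Definition vandermonde n (S : 'I_n -> R * R) (p : nat) : 'M[R]_(n, etap p) :=
  \matrix_(i < n, k < etap p) mono k (S i).

Definition bounded2 (Om : set (R * R)) : Prop :=
  exists M : R, forall z, Om z -> `|z.1| <= M /\ `|z.2| <= M.

(* at the boundary point z with tangent v = (a,b), the normal (b,-a) points
   out of Om: for small h > 0, z + h (b,-a) is outside Om, z - h (b,-a) inside *)
Definition outward_at (Om : set (R * R)) (z v : R * R) : Prop :=
  exists e : R, 0 < e /\ forall h : R, 0 < h < e ->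
    ~ Om (z.1 + h * v.2, z.2 - h * v.1) /\ Om (z.1 - h * v.2, z.2 + h * v.1).

(* The boundary Gamma of Om is given by c closed, piecewise C^1, regular
   curves g j : [0,1] -> R^2, positively oriented (outward normal (y', -x')),
   whose union of images is the topological boundary of Om, and which
   cover every boundary point exactly once except at finitely many break
   points. *)
Definition pw_smooth_boundary (Om : set (R * R)) (c : nat)
    (g : 'I_c -> R -> R * R) : Prop :=
  [/\ forall j, g j 0 = g j 1,
      forall j, exists (m : nat) (t : nat -> R),
        [/\ t 0%N = 0, t m = 1, (forall i, (i < m)%N -> t i < t i.+1) &
          forall i, (i < m)%N -> exists h1 h2 : R -> R,
            [/\ forall s, t i <= s <= t i.+1 -> g j s = (h1 s, h2 s),
                (forall s, derivable h1 s 1 /\ derivable h2 s 1) /\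
                (continuous (derive1 h1) /\ continuous (derive1 h2)),
                forall s, t i <= s <= t i.+1 -> ((derive1 h1) s, (derive1 h2) s) != 0,
                forall s, t i < s < t i.+1 ->
                  outward_at Om (g j s) ((derive1 h1) s, (derive1 h2) s) &
                forall s, t i < s < t i.+1 -> forall j' s', 0 <= s' <= 1 ->
                  g j' s' = g j s -> j' = j /\ s' = s]] &
      closure Om `\` Om = [set z | exists j s, 0 <= s <= 1 /\ z = g j s]].

(* boundary integrals  \oint_Gamma f n_x dGamma  and  \oint_Gamma f n_y dGamma
   (n_x dGamma = y'(t) dt,  n_y dGamma = - x'(t) dt) *)
Definition bint_x c (g : 'I_c -> R -> R * R) (f : R * R -> R) : R :=
  \sum_(j < c) \int[lebesgue_measure]_(t in `[0, 1]%classic)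
      (f (g j t) * derive1 (fun u => (g j u).2) t).
Definition bint_y c (g : 'I_c -> R -> R * R) (f : R * R -> R) : R :=
  \sum_(j < c) \int[lebesgue_measure]_(t in `[0, 1]%classic)
      (- (f (g j t) * derive1 (fun u => (g j u).1) t)).

Definition area :=
  (@lebesgue_measure R \x @lebesgue_measure R)%E.

Definition pos_cubature (Om : set (R * R)) n (S : 'I_n -> R * R) (p : nat) :=
  exists w : 'I_n -> R, (forall i, 0 < w i) /\
    forall coef : nat -> nat -> R,
      let f := fun z : R * R => \sum_(a < (2 * p)%N) \sum_(b < (2 * p - a)%N)
                  coef a b * (z.1 ^+ a * z.2 ^+ b) in
      \sum_(i < n) w i * f (S i) = \int[area]_(z in Om) f z.

Definition SBP_op n (S : 'I_n -> R * R) (dmono : nat -> R * R -> R)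
    (bint : (R * R -> R) -> R) (p : nat) (diag_norm : bool)
    (D : 'M[R]_n) : Prop :=
  exists (H QA E : 'M[R]_n) (tau : nat),
  [/\ (p <= tau)%N /\
      (forall k, (k < etap p)%N -> D *m nodevec S (mono k) = nodevec S (dmono k)),
      H^T = H /\ (forall v : 'cV[R]_n, v != 0 -> 0 < (v^T *m H *m v) 0 0),
      D = invmx H *m (QA + 2^-1 *: E) /\ (QA^T = - QA /\ E^T = E),
      forall k m, (k < etap tau)%N -> (m < etap tau)%N ->
        ((nodevec S (mono k))^T *m E *m nodevec S (mono m)) 0 0
          = bint (fun z => mono k z * mono m z) &
      diag_norm ==> is_diag_mx H].

Definition SBP_x n S c g p (D : 'M[R]_n) :=
  SBP_op S mono_dx (@bint_x c g) p true D.
Definition SBP_y n S c g p (D : 'M[R]_n) :=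
  SBP_op S mono_dy (@bint_y c g) p true D.

End Defs.

(* Main.v *)
Require Import Defs.
From HB Require Import structures.
From mathcomp Require Import all_boot all_order all_algebra.
From mathcomp Require Import all_classical all_reals all_analysis.
From mathcomp Require Import measurable_realfun.
From mathcomp Require Import ring lra zify.
Import Order.TTheory GRing.Theory Num.Theory.
Import numFieldNormedType.Exports.
Local Open Scope classical_set_scope.
Local Open Scope ring_scope.

(** By Green's formula, the boundary integral of [P_k P_m n_x] equals the integral
    over [Om] of the derivative of [P_k P_m].  Given SBP operators with norm
    [H = diag w], the identity [Q + Q^T = E] then says that the rule with weights
    [w] is exact for the derivatives of all products [P_k P_m], and these span the
    polynomials of degree at most [2p - 1].  Conversely, exactness of the rule makes
    [V^T (H V_x - E V / 2)] antisymmetric, where [E] realizes the boundary form on the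
    column space of [V], and this is the solvability condition for [Q^A].

    Green's formula is obtained by slicing.  For almost every height [y] (Sard) the
    boundary crosses the horizontal line transversally, hence finitely often, and
    each crossing separates the inside from the outside, so that the integral of
    [F_x] over the slice is a signed sum of values of [F] at the crossings.  The same
    signed sum, read along the arcs, is the integral of the derivative of [F] along
    the part of the arcs above height [y] (up to end terms); integrating in [y] by
    Fubini and integrating by parts gives the line integral of [F dy]. *)

Set Implicit Arguments.
Unset Strict Implicit.

(** * Signed crossings on the real line *)

Section OneDim.
Variable R : realType.
Implicit Types (f : R -> R) (O : set R).

(** This is connectedness of the line, obtained from the vanishing of the derivative. *)
Lemma locally_constant_eq f : (forall x, \forall y \near x, f y = f x) ->
  forall x y, f x = f y.
Proof.
move=> fc x y; apply: is_derive_0_is_cst => z.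
apply: (@near_eq_is_derive _ _ _ (cst (f z)) f z 1 0 _ (is_derive_cst _ _ _)).
by apply: filterS (fc z) => w ->.
Qed.

(* The value at [x = p] is the one that makes the difference in [crossing_count]
   constant even at the crossings. *)
Definition side (b : bool) (p x : R) : bool := if b then x < p else x <= p.

Lemma side_locally_constant b (p x : R) : x != p ->
  \forall y \near x, side b p y = side b p x.
Proof.
rewrite neq_lt => /orP[xp|px].
- near=> y; have yp : y < p by near: y; exact: lt_nbhsl.
  by rewrite /side yp xp !ltW.
- near=> y; have yp : p < y by near: y; exact: lt_nbhsr.
  by rewrite /side (lt_gtF yp) (lt_gtF px) (lt_geF yp) (lt_geF px).
Unshelve. all: by end_near. Qed.

(* [b] tells that [O] lies on the left of its boundary point [p]. *)
Definition crossing O (b : bool) (p : R) :=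
  ~ O p /\ \forall h \near 0^'+, (O (p - h) <-> b) /\ (O (p + h) <-> ~~ b).

(** At a crossing, [\1_O] and the signed step function attached to that point jump by the same
    amount; elsewhere both are locally constant. Their difference is therefore locally constant on
    the whole line. *)
Lemma crossing_count (T : eqType) (P : seq T) (p : T -> R) (s : T -> bool) O :
  uniq P -> {in P &, injective p} ->
  (forall x, (forall t, t \in P -> x != p t) -> \forall y \near x, O y <-> O x) ->
  (forall t, t \in P -> crossing O (s t) (p t)) ->
  forall x y,
    \1_O x - \sum_(t <- P) (-1) ^+ (~~ s t) * (side (s t) (p t) x)%:R =
    \1_O y - \sum_(t <- P) (-1) ^+ (~~ s t) * (side (s t) (p t) y)%:R :> R.
Proof.
move=> uP pinj Oc cr; apply: locally_constant_eq => x.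
have sumc (Q : seq T) : (forall t, t \in Q -> x != p t) -> \forall y \near x,
    \sum_(t <- Q) (-1) ^+ (~~ s t) * (side (s t) (p t) y)%:R =
    \sum_(t <- Q) (-1) ^+ (~~ s t) * (side (s t) (p t) x)%:R :> R.
  elim: Q => [|t Q IH] Qx; first by near=> y; rewrite !big_nil.
  have {}IH := IH (fun u uQ => Qx u (mem_behead (s:=t::Q) uQ)).
  have tx := side_locally_constant (s t) (Qx t (mem_head _ _)).
  near=> y; rewrite !big_cons; congr (_ * _%:R + _).
    by congr nat_of_bool; near: y.
  by near: y.
have indE z : \1_O z = (asbool (O z))%:R :> R by rewrite indicE; congr (nat_of_bool _)%:R; apply/idP/asboolP => [/set_mem|/mem_set].
have [/hasP[t tP /eqP xt]|/hasPn xP] := boolP (has (fun t => x == p t) P); last first.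
  have xP' t : t \in P -> x != p t by move=> /xP.
  have h1 := sumc P xP'; have h2 := Oc _ xP'.
  near=> y; congr (_ - _); last by near: y.
  rewrite !indE; congr (nat_of_bool _)%:R; apply: asbool_equiv_eq.
  by near: y.
(* At a crossing only the term of [t] and the indicator can change: by injectivity the other
   crossings stay away from [x]. *)
have /sumc restc : forall u, u \in rem t P -> x != p u.
  move=> u; rewrite mem_rem_uniq // inE => /andP[ut uP'].
  by apply: contra ut; rewrite xt => /eqP /pinj -> //.
have [Op cross] := cr t tP.
have [d /= d0 Hd] : exists2 d : R, 0 < d & forall h, 0 < h < d ->
   (O (p t - h) <-> s t) /\ (O (p t + h) <-> ~~ s t).
  case: cross => d /= d0 Hd; exists d => // h /andP[h0 hd].
  by apply: Hd => //=; rewrite sub0r normrN gtr0_norm.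
near=> y.
rewrite !(big_rem t tP) /= !opprD !addrA; congr (_ - _); last by near: y.
rewrite !indE xt (asboolF Op) [side _ _ (p t)]/side.
have yd : `|p t - y| < d by near: y; rewrite xt; exists d.
rewrite ltxx lexx; have [yx|yx|->] := ltgtP y (p t).
- have /Hd[+ _] : 0 < p t - y < d by rewrite subr_gt0 yx -(gtr0_norm (x := p t - y)) ?subr_gt0.
  rewrite subKr => E; rewrite (asbool_equiv_eq E) asboolb.
  by rewrite /side yx ltW //; case: (s t) => /=; rewrite ?expr0 ?expr1; lra.
- have /Hd[_ +] : 0 < y - p t < d by rewrite subr_gt0 yx -(gtr0_norm (x := y - p t)) ?subr_gt0 // distrC.
  rewrite subrKC => E; rewrite (asbool_equiv_eq E) asboolb.
  by rewrite /side (lt_gtF yx) (lt_geF yx); case: (s t) => /=; rewrite ?expr0 ?expr1; lra.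
- by rewrite (asboolF Op) /side ltxx lexx.
Unshelve. all: by end_near. Qed.

End OneDim.

(** * C1 functions and integrals over an interval cut at crossings *)

Definition C1 (R : realType) (f : R -> R) :=
  (forall x, derivable f x 1) /\ continuous (derive1 f).

Section Integrals.
Variable R : realType.
Implicit Types (f : R -> R) (a b : R).
Local Notation mu := (@lebesgue_measure R).

Lemma C1_continuous f : C1 f -> continuous f.
Proof. by move=> [df _] x; apply/differentiable_continuous/derivable1_diffP. Qed.

Lemma C1_LRcontinuous f a b : C1 f -> derivable_oo_LRcontinuous f a b.
Proof.
move=> Cf; have cf := C1_continuous Cf; split=> [x _||]; first exact: Cf.1.
- exact: cvg_at_right_filter (cf a).
- exact: cvg_at_left_filter (cf b).
Qed.

Lemma continuous_integrable f a b : continuous f ->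
  mu.-integrable `[a, b] (EFin \o f).
Proof.
move=> cf; apply: continuous_compact_integrable; first exact: segment_compact.
exact: continuous_subspaceT.
Qed.

Lemma integral_C1 f a b : C1 f -> a <= b ->
  \int[mu]_(x in `[a, b]) (derive1 f) x = f b - f a.
Proof.
move=> Cf; rewrite le_eqVlt => /predU1P[->|ab].
  by rewrite set_itv1 Rintegral_set1 subrr.
rewrite /Rintegral (continuous_FTC2 (F := f)) //.
- by apply: continuous_subspaceT; exact: Cf.2.
- exact: C1_LRcontinuous.
Qed.

Lemma Rintegral_sum d (T : measurableType d) (m : measure T R) (D : set T) I (s : seq I)
    (h : I -> T -> R) : d.-measurable D ->
  (forall i, m.-integrable D (EFin \o h i)) ->
  m.-integrable D (EFin \o (fun x => \sum_(i <- s) h i x)) /\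
  \int[m]_(x in D) (\sum_(i <- s) h i x) = \sum_(i <- s) \int[m]_(x in D) h i x.
Proof.
move=> mD ih; elim: s => [|i s [IH1 IH2]].
  have -> : (fun x => \sum_(i <- [::]) h i x) = cst 0 by apply/funext => x; rewrite big_nil.
  split; first exact: integrable0.
  by rewrite big_nil Rintegral_cst // mul0r.
have -> : (fun x => \sum_(j <- i :: s) h j x) = (fun x => h i x + \sum_(j <- s) h j x).
  by apply/funext => x; rewrite big_cons.
split; last by rewrite RintegralD // IH2 big_cons.
by have := integrableD mD (ih i) IH1.
Qed.

Lemma side_integrable f (s : bool) (p a b : R) : continuous f ->
  mu.-integrable `[a, b] (EFin \o (fun x => (side s p x)%:R * f x)).
Proof.
move=> cf; refine (le_integrable _ _ _ (continuous_integrable a b cf)) => //.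
- apply/measurable_EFinP; apply: measurable_funM; last first.
    by apply: measurable_funTS; exact: continuous_measurable_fun.
  have -> : (fun x => (side s p x)%:R) = \1_(if s then `]-oo, p[ else `]-oo, p])%classic :> (R -> R).
    apply/funext => x; rewrite indicE; congr (nat_of_bool _)%:R.
    by case: s; rewrite /side; apply/idP/idP; rewrite inE /= in_itv.
  by apply: measurable_indic; case: s.
- move=> x _ /=; rewrite lee_fin normrM ler_piMl //.
  by rewrite ger0_norm ?ler0n // lern1 leq_b1.
Qed.

Lemma side_integral f (s : bool) (p a b : R) : C1 f -> a < p < b ->
  \int[mu]_(x in `[a, b]) ((side s p x)%:R * (derive1 f) x) = f p - f a.
Proof.
move=> Cf /andP[ap pb].
have iside := @side_integrable (derive1 f) s p a b Cf.2.
have -> : `[a, b]%classic = `[a, p]%classic `|` `]p, b]%classic.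
  by rewrite -itv_bndbnd_setU // bnd_simp ltW.
rewrite Rintegral_setU //; last 2 first.
- by rewrite -itv_bndbnd_setU // bnd_simp ltW.
- apply/disj_set2P; rewrite -subset0 => x [] /=; rewrite !in_itv /=.
  by move=> /andP[_ xp] /andP[+ _]; rewrite ltNge xp.
rewrite [X in _ + X](_ : _ = 0) ?addr0; last first.
  rewrite (eq_Rintegral mu (g := cst 0)) ?Rintegral_cst ?mul0r// => x.
  rewrite inE /= in_itv /= => /andP[px _].
  by rewrite /side (lt_gtF px) (lt_geF px) if_same mul0r.
rewrite -integral_C1 ?(ltW ap)//.
rewrite -Rintegral_itv_bndo_bndc; last first.
  apply: integrableS iside => //.
  by apply: subset_itvl; rewrite bnd_simp ltW.
rewrite -[RHS]Rintegral_itv_bndo_bndc; last first.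
  by apply: integrableS (continuous_integrable a p Cf.2) => //; apply: subset_itvl; rewrite bnd_simp.
apply: eq_Rintegral => x; rewrite inE /= in_itv /= => /andP[_ xp].
by rewrite /side xp ltW // if_same mul1r.
Qed.

(** By [crossing_count], [\1_O] is a constant plus a signed sum of indicators of half-lines, and the
    half-line ending at [p t] contributes [f (p t) - f a]. *)
Lemma crossing_integral (T : eqType) (P : seq T) (p : T -> R) (s : T -> bool)
    (O : set R) f a b :
  a < b -> C1 f ->
  uniq P -> {in P &, injective p} ->
  (forall x, (forall t, t \in P -> x != p t) -> \forall y \near x, O y <-> O x) ->
  (forall t, t \in P -> crossing O (s t) (p t)) ->
  (forall t, t \in P -> a < p t < b) ->
  \int[mu]_(x in `[a, b]) (\1_O x * (derive1 f) x) =
  \1_O b * f b - \1_O a * f a + \sum_(t <- P) (-1) ^+ (~~ s t) * f (p t).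
Proof.
move=> ab Cf uP pinj Oc cr pab.
have cnt := crossing_count uP pinj Oc cr.
(* At [b] every [side] is 0, at [a] every one is 1. Comparison with [b] expresses [\1_O]; comparison
   of [a] with [b] evaluates the sum of the signs. *)
have sideb : \sum_(t <- P) (-1) ^+ (~~ s t) * (side (s t) (p t) b)%:R = 0 :> R.
  rewrite big_seq big1 // => t /pab /andP[_ pb].
  by rewrite /side (lt_gtF pb) (lt_geF pb) if_same mulr0.
have sidea : \sum_(t <- P) (-1) ^+ (~~ s t) * (side (s t) (p t) a)%:R =
    \sum_(t <- P) (-1) ^+ (~~ s t) :> R.
  rewrite big_seq [RHS]big_seq; apply: eq_bigr => t /pab /andP[pa _].
  by rewrite /side pa ltW // if_same mulr1.
have EO x : \1_O x = \1_O b +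
    \sum_(t <- P) (-1) ^+ (~~ s t) * (side (s t) (p t) x)%:R :> R.
  by have := cnt x b; rewrite sideb subr0 => <-; rewrite subrK.
have Ea := EO a; rewrite sidea in Ea.
have iside t := @side_integrable (derive1 f) (s t) (p t) a b Cf.2.
have iside' t : mu.-integrable `[a, b] (EFin \o (fun x =>
    (-1) ^+ (~~ s t) * ((side (s t) (p t) x)%:R * (derive1 f) x))).
  by have := integrableZl _ ((-1) ^+ (~~ s t)) (iside t); apply.
have cint := continuous_integrable a b Cf.2.
have cint' : mu.-integrable `[a, b] (EFin \o (fun x => \1_O b * (derive1 f) x)).
  by have := integrableZl _ (\1_O b) cint; apply.
have [|int1 int2] := Rintegral_sum P _ iside'; first by [].
under eq_Rintegral.
  move=> x _; rewrite EO mulrDl mulr_suml; under eq_bigr do rewrite -mulrA; over.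
rewrite RintegralD // int2 RintegralZl // integral_C1 ?ltW //.
rewrite (_ : \sum_(t <- P) \int[mu]_(x in _) _ = \sum_(t <- P) (-1) ^+ (~~ s t) * f (p t) -
    (\sum_(t <- P) (-1) ^+ (~~ s t)) * f a); first by rewrite Ea; ring.
rewrite mulr_suml -sumrB big_seq [RHS]big_seq; apply: eq_bigr => t tP.
by rewrite RintegralZl // side_integral // ?mulrBr // pab.
Qed.

End Integrals.

(** * Level sets of C1 functions *)

Section LevelSets.
Variable R : realType.
Implicit Types (Y : R -> R) (l r y : R).
Local Notation mu := (@lebesgue_measure R).

(** Heine's theorem, with only one of the two points confined to the segment. *)
Lemma segment_unif_continuous (f : R -> R) l r (e : R) : continuous f -> 0 < e ->
  exists2 d : R, 0 < d &
    forall x z, l <= x <= r -> `|z - x| < d -> `|f z - f x| < e.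
Proof.
move=> cf e0.
have /compact_near_coveringP nc := @segment_compact R l r.
pose Q (d x : R) := forall z, `|z - x| < d -> `|f z - f x| < e.
have [x xlr|d /= d0 Hd] := nc R (0^'+) Q _.
  have e2 : 0 < e / 2 by rewrite divr_gt0.
  have /cvgrPdist_lt /(_ _ e2) [d /= d0 Hd] := cf x.
  exists (ball x (d / 2), [set h | 0 < h < d / 2]).
    split; first by apply: nbhsx_ballx; rewrite divr_gt0.
    exists (d / 2) => /=; first by rewrite divr_gt0.
    move=> h /=; rewrite sub0r normrN => hd h0; rewrite h0 /=.
    by rewrite (le_lt_trans _ hd) // ler_norm.
  move=> [x' h] [/= xx' /andP[h0 hd]] z zx'.
  have d2 : d / 2 < d by rewrite ltr_pdivrMr // ltr_pMr // ltr1n.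
  have H1 := Hd x' (lt_trans xx' d2).
  have /Hd H2 : `|x - z| < d.
    rewrite (_ : x - z = (x - x') - (z - x')); last by ring.
    rewrite (le_lt_trans (ler_normB _ _)) // [ltRHS](splitr d) ltrD //.
    exact: lt_trans zx' hd.
  rewrite (_ : f z - f x' = (f x - f x') - (f x - f z)); last by ring.
  by rewrite (le_lt_trans (ler_normB _ _)) // [ltRHS](splitr e) ltrD.
exists (d / 2); first by rewrite divr_gt0.
move=> x z xlr zx; apply: (Hd (d / 2)) zx => //=.
- by rewrite sub0r normrN gtr0_norm ?divr_gt0 // ltr_pdivrMr // ltr_pMr // ltr1n.
- by rewrite divr_gt0.
Qed.

(** The one-dimensional Sard theorem. On a short cell containing a critical point the derivative is
    small throughout, by uniform continuity, so the critical values from that cell lie in an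
    interval much shorter than the cell. *)
Lemma critical_values_negligible Y l r : C1 Y -> l < r ->
  mu.-negligible [set y | exists s, [/\ l <= s <= r, Y s = y & (derive1 Y) s = 0]].
Proof.
move=> CY lr.
set K := [set _ | _].
have mK : measurable (K : set (measurableTypeR R)).
  apply: compact_measurable.
  have -> : K = Y @` (`[l, r]%classic `&` (derive1 Y) @^-1` [set 0]).
    apply/seteqP; split=> y.
      by move=> [s [slr Ys Y0]]; exists s => //; split => //=; rewrite in_itv.
    by move=> [s [/= slr Y0] Ys]; exists s; split => //; move: slr; rewrite in_itv.
  apply: continuous_compact.
    by apply: continuous_subspaceT; exact: C1_continuous.
  apply: subclosed_compact (@segment_compact R l r) _; last by move=> x [].
  apply: closedI; first exact: itv_closed.
  by move/continuous_closedP: (CY.2); apply; exact: closed_eq.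
exists K; split => //.
apply/eqP; rewrite eq_le measure_ge0 andbT; apply/lee_addgt0Pr => e e0.
rewrite add0e.
(* Within a cell of a fine mesh, the critical points have values at distance at
   most [e' * len] from the value at the left end of the cell. *)
pose e' := e / (4 * (r - l)).
have rl0 : 0 < r - l by rewrite subr_gt0.
have e'0 : 0 < e' by rewrite divr_gt0 // mulr_gt0.
have [d d0 Hd] := segment_unif_continuous l r CY.2 e'0.
pose N := Num.trunc ((r - l) / d).
pose len := (r - l) / N.+1%:R.
have len0 : 0 < len by rewrite divr_gt0.
have lend : len < d.
  rewrite ltr_pdivrMr // mulrC -ltr_pdivrMr // /N.
  exact: truncnS_gt.
pose m (i : nat) := l + i%:R * len.
pose B (i : nat) : set (measurableTypeR R) := `[Y (m i) - e' * len, Y (m i) + e' * len]%classic.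
(* The cell index equals [N.+1] when [s = r], hence [N.+2] cells. *)
have KB : K `<=` \big[setU/set0]_(i < N.+2) B i.
  move=> y [s [/andP[ls sr] <- Y0]].
  pose i := Num.trunc ((s - l) / len).
  have q0 : 0 <= (s - l) / len by rewrite divr_ge0 ?subr_ge0 // ltW.
  have /andP[i1 i2] := truncn_itv q0.
  have iN : (i < N.+2)%N.
    rewrite ltnS -(ler_nat R) (le_trans i1) //.
    rewrite ler_pdivrMr // mulrC /len divfK //; first by rewrite lerB.
  rewrite -bigcup_mkord; exists i => //=.
  have mi : m i <= s by rewrite /m -lerBrDl -ler_pdivlMr.
  have si : s - m i <= len.
    by move: i2; rewrite ltr_pdivrMr // -natr1 /m => H; apply: ltW; lra.
  have [] := @MVT_segment R Y (derive1 Y) (m i) s mi.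
  - by move=> x _; apply: DeriveDef; [exact: CY.1|rewrite derive1E].
  - by apply: continuous_subspaceT; exact: C1_continuous.
  move=> c; rewrite in_itv /= => /andP[mc cs] E.
  have : `|(derive1 Y) c - (derive1 Y) s| < e'.
    apply: Hd; first by rewrite ls sr.
    by rewrite distrC ger0_norm ?subr_ge0 // (le_lt_trans _ lend) // (le_trans _ si) // lerD2l lerN2.
  rewrite Y0 subr0 => /ltW ce.
  have : `|Y s - Y (m i)| <= e' * len.
    by rewrite E normrM ler_pM // ger0_norm ?subr_ge0.
  by rewrite /B /= in_itv /= ler_distl.
apply: le_trans (le_measure mu _ _ KB) _; rewrite ?inE //.
  by apply: bigsetU_measurable => i _; exact: measurable_itv.
apply: le_trans (Boole_inequality mu (A := B) _) _.
  by move=> i _; exact: measurable_itv.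
have el0 : 0 < e' * len by rewrite mulr_gt0.
have EB i : mu (B i) = (2 * (e' * len))%:E.
  rewrite /B lebesgue_measure_itv /= lte_fin ifT; last by lra.
  by rewrite -EFinB; congr EFin; ring.
rewrite (eq_bigr (fun=> (2 * (e' * len))%:E)); last by move=> i _; exact: EB.
rewrite sumEFin lee_fin sumr_const card_ord.
rewrite -[leLHS]mulr_natl -(natr1 N.+1).
have a1 : 1 <= N.+1%:R :> R by rewrite ler1n.
rewrite /e' /len; move: (N.+1%:R) a1 => a a1.
(* Here [a = N.+1]. The 4 in [e'] absorbs the 2 in the length of each interval and the bound 2 on
   the ratio of the number of intervals to [a]. *)
rewrite [leLHS](_ : _ = (a + 1) / a * (e / 2)); last first.
  by field; apply/andP; split; lra.
have a2 : (a + 1) / a <= 2 by rewrite ler_pdivrMr; lra.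
by apply: le_trans (ler_wpM2r (ltW (divr_gt0 e0 (ltr0n R 2))) a2) _; lra.
Qed.
End LevelSets.

Section Roots.
Variable R : realType.
Implicit Types (Y phi : R -> R) (l r y : R).
Local Notation mu := (@lebesgue_measure R).

(** Carathéodory's form of differentiability: near [x], the sign of [Y z - Y x] can be read off a
    factor continuous at [x]. *)
Lemma C1_slope Y x : C1 Y -> exists g : R -> R,
  [/\ forall z, Y z - Y x = g z * (z - x), {for x, continuous g} & g x = (derive1 Y) x].
Proof.
move=> CY; apply/is_derive1_caratheodory; apply: DeriveDef; first exact: CY.1.
by rewrite derive1E.
Qed.

(** The end values are excluded so that every crossing is interior to its arc, where the normal and
    the simplicity of the boundary are known. *)
Definition regular_value Y l r y := [/\ y != Y l, y != Y r &
  forall s, l <= s <= r -> Y s = y -> (derive1 Y) s != 0].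

Lemma regular_value_ae Y l r : C1 Y -> l < r ->
  \forall y \ae mu, regular_value Y l r y.
Proof.
move=> CY lr.
have n1 := critical_values_negligible CY lr.
have n2 (a : R) : mu.-negligible [set a].
  by exists [set a]; split => //; rewrite lebesgue_measure_set1.
apply: (negligibleS _ (negligibleU n1 (negligibleU (n2 (Y l)) (n2 (Y r))))).
move=> y /= ny; apply: contrapT => /not_orP[H1 /not_orP[H2 H3]]; apply: ny.
split; [exact/eqP|exact/eqP|] => s lsr Ys; apply/eqP => Y0.
by apply: H1; exists s.
Qed.

(** Every point of the segment has a neighbourhood in which it is the only possible root, because
    the slope does not vanish at a regular root. The roots are then among the centres of a finite
    subcover. *)
Lemma finite_roots Y l r y : C1 Y -> l < r -> regular_value Y l r y ->
  exists P : seq R, uniq P /\ forall s, (s \in P) = (l < s < r) && (Y s == y).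
Proof.
move=> CY lr [yl yr reg].
have cY := C1_continuous CY.
pose f (x : R) := interior [set z | Y z = y -> z = x].
have /= fx x : l <= x <= r -> f x x.
  move=> xlr; rewrite /f /interior /=.
  have [Yx|Yx] := eqVneq (Y x) y; last first.
    have /cvgr_neq0 : Y z - y @[z --> x] --> Y x - y.
      by apply: cvgB; [exact: cY|exact: cvg_cst].
    by rewrite subr_eq0 => /(_ Yx); apply: filterS => z /= /[swap] ->; rewrite subrr eqxx.
  have [g [gE gc gx]] := C1_slope x CY.
  have : g x != 0 by rewrite gx; exact: reg.
  move/(cvgr_neq0 _ gc); apply: filterS => z /= gz Yz; apply/eqP.
  by have /eqP := gE z; rewrite Yz Yx subrr eq_sym mulf_eq0 (negPf gz) subr_eq0.
have := @segment_compact R l r; rewrite compact_cover.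
move/(_ R [set x | l <= x <= r] f) => [|x /= xlr|D _ cov].
- by move=> x _; exact: open_interior.
- by exists x; [move: xlr; rewrite in_itv|apply: fx; move: xlr; rewrite in_itv].
exists [seq s <- undup (finmap.enum_fset D) | (l < s < r) && (Y s == y)].
split; first by rewrite filter_uniq ?undup_uniq.
move=> s; rewrite mem_filter mem_undup.
case: (boolP ((l < s < r) && _)) => //= /andP[/andP[ls sr] /eqP Ys].
have [|d /= dD /interior_subset /= /(_ Ys) ->//] := cov s.
by rewrite /= in_itv /= !ltW.
Qed.

(** Composition with [clamp] extends a function on a segment by constants to a continuous function
    on the line, creating no crossing at the ends. *)
Definition clamp l r (x : R) := Order.max l (Order.min r x).

Lemma clamp_continuous l r : continuous (clamp l r).
Proof.
move=> x; apply: continuous_max; first exact: cvg_cst.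
by apply: continuous_min; [exact: cvg_cst|exact: cvg_id].
Qed.

Lemma clamp_id l r x : l <= x <= r -> clamp l r x = x.
Proof. by move=> /andP[lx xr]; rewrite /clamp min_r ?max_r. Qed.

Lemma clamp_itv l r x : l <= r -> l <= clamp l r x <= r.
Proof. by move=> lr; rewrite /clamp le_max lexx ge_max lr ge_min lexx. Qed.

Lemma clamp_itvoo l r x : l < clamp l r x < r -> clamp l r x = x.
Proof.
rewrite /clamp; case: (leP r x) => [rx|xr].
  by case: (leP l r) => _; rewrite ltxx ?andbF.
by case: (leP l x) => // _; rewrite ltxx.
Qed.

(** This is [crossing_integral] for the set where the extended [Y] exceeds [y]: its crossings are
    the roots in [P], and the set lies to the left of a root exactly when [Y] decreases there. *)
Lemma level_integral Y phi l r y (P : seq R) : C1 Y -> C1 phi -> l < r ->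
  regular_value Y l r y -> uniq P ->
  (forall s, (s \in P) = (l < s < r) && (Y s == y)) ->
  \int[mu]_(s in `[l, r]) ((y < Y s)%R%:R * (derive1 phi) s) =
  (y < Y r)%R%:R * phi r - (y < Y l)%R%:R * phi l -
  \sum_(s <- P) (-1) ^+ ((derive1 Y) s < 0)%R * phi s.
Proof.
move=> CY Cphi lr [yl yr reg] uP PE.
have cY := C1_continuous CY.
pose O := [set s | y < Y (clamp l r s)].
have OE s : l <= s <= r -> \1_O s = (y < Y s)%R%:R :> R.
  move=> lsr; rewrite indicE; congr (nat_of_bool _)%:R.
  by apply/idP/idP; rewrite inE /O /= clamp_id.
rewrite (eq_Rintegral mu (g := fun s => \1_O s * (derive1 phi) s)); last first.
  by move=> s; rewrite inE /= in_itv /= => lsr; rewrite OE.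
rewrite (crossing_integral (P := P) (p := id) (s := fun s => (derive1 Y) s < 0) lr Cphi uP) //.
- rewrite !OE ?lexx ?ltW // -sumrN; congr (_ + _).
  by apply: eq_bigr => s _; case: (_ < 0); rewrite ?expr0 ?expr1; ring.
- move=> x xP.
  have cYc : continuous (Y \o clamp l r).
    by move=> z; apply: continuous_comp; [exact: clamp_continuous|exact: cY].
  have : Y (clamp l r x) != y.
    apply/eqP => Yx; have /andP[lc cr] := clamp_itv x (ltW lr).
    have cx : l < clamp l r x < r.
      rewrite !lt_neqAle lc cr !andbT; apply/andP; split.
        by apply: contra_neq yl => E; rewrite -Yx -E.
      by apply: contra_neq yr => E; rewrite -Yx E.
    have xE := clamp_itvoo cx.
    have /xP : x \in P by rewrite PE -xE cx xE -[in Y x]xE Yx eqxx.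
    by rewrite eqxx.
  rewrite neq_lt => /orP[Yx|Yx].
    have H : \forall z \near x, Y (clamp l r z) < y by exact: (cvgr_lt _ (cYc x) _ Yx).
    near=> z; have Yz : Y (clamp l r z) < y by near: z.
    by rewrite /O /=; split; [move/(lt_trans Yz)|move/(lt_trans Yx)]; rewrite ltxx.
  have H : \forall z \near x, y < Y (clamp l r z) by exact: (cvgr_gt _ (cYc x) _ Yx).
  by near=> z; split => // _; near: z.
- move=> t; rewrite PE => /andP[/andP[lt tr] /eqP Yt].
  split; first by rewrite /O /= clamp_id ?ltW ?lt ?tr // Yt ltxx.
  have [g [gE gc gt]] := C1_slope t CY.
  have gt0 : g t != 0 by rewrite gt; apply: reg => //; rewrite !ltW.
  have Hn : \forall z \near t, 0 < g z * g t.
    have /cvgr_gt : g z * g t @[z --> t] --> g t * g t.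
      by apply: cvgM; [exact: gc|exact: cvg_cst].
    by apply; rewrite -expr2 exprn_even_gt0.
  have lz : \forall z \near t, l < z by exact: lt_nbhsr.
  have zr : \forall z \near t, z < r by exact: lt_nbhsl.
  have [d /= d0 Hd] : nbhs t [set z | [/\ 0 < g z * g t, l < z & z < r]].
    by near=> z; split; near: z.
  (* Near the root [t], the slope [g z] has the sign of [g t], hence [Y z - y] has the sign of
     [g t * (z - t)]. *)
  have OH z : `|t - z| < d -> O z <-> 0 < g t * (z - t).
    move=> /Hd /= [gz lz' zr'].
    rewrite /O /= clamp_id ?ltW ?lz' // -subr_gt0 -Yt gE.
    move: gz; have [gz0 gz|gz0 gz|->] := ltgtP (g z) 0; last by rewrite mul0r ltxx.
      by rewrite nmulr_rgt0 // nmulr_rgt0 // -(nmulr_rgt0 _ gz0).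
    by rewrite pmulr_rgt0 // pmulr_rgt0 // -(pmulr_rgt0 _ gz0).
  rewrite -gt; exists d => // h /=; rewrite sub0r normrN => hd h0.
  have [OH1 OH2] := (OH (t - h), OH (t + h)).
  rewrite OH1; last by rewrite opprB addrC subrK.
  rewrite OH2; last by rewrite opprD addrA subrr add0r normrN.
  rewrite (_ : t - h - t = - h); last by ring.
  rewrite (_ : t + h - t = h); last by ring.
  rewrite mulrN oppr_gt0 pmulr_llt0 // pmulr_lgt0 // -leNgt.
  by split=> //; rewrite le_eqVlt eq_sym (negPf gt0).
- by move=> t; rewrite PE => /andP[].
Unshelve. all: by end_near. Qed.

End Roots.

(** * Crossings of a piecewise smooth boundary *)

Section Geometry.
Variable R : realType.
Implicit Types (Om : set (R * R)).

(* The arcs are traversed so that [Om] lies on the left if [sg = 1], and on the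
   right if [sg = -1]; the latter occurs after exchanging the two coordinates. *)
Record arc_boundary (sg : R) Om (A : finType) (X Y : A -> R -> R) (l r : A -> R) : Prop := {
  arc_sg : sg ^+ 2 = 1;
  arc_lr : forall a, l a < r a;
  arc_C1X : forall a, C1 (X a);
  arc_C1Y : forall a, C1 (Y a);
  arc_cover : closure Om `\` Om =
    [set z | exists a s, l a <= s <= r a /\ z = (X a s, Y a s)];
  arc_outward : forall a s, l a < s < r a ->
    outward_at Om (X a s, Y a s) (sg * derive1 (X a) s, sg * derive1 (Y a) s);
  arc_simple : forall a s, l a < s < r a -> forall b s', l b <= s' <= r b ->
    (X b s', Y b s') = (X a s, Y a s) -> b = a /\ s' = s }.

(** As [Om] is open, [closure Om] minus [Om] is its topological boundary, and the complement of the
    boundary consists of the two open sets [Om] and the exterior. *)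
Lemma locally_constant_off_boundary Om (q : R * R) : open Om ->
  ~ (closure Om `\` Om) q -> \forall z \near q, Om z <-> Om q.
Proof.
move=> oOm nq; have [Oq|nOq] := pselect (Om q).
  by have := open_nbhs_nbhs (conj oOm Oq); apply: filterS => z Oz; split.
have : ~ closure Om q by move=> cq; apply: nq.
have oC : open (~` closure Om) by apply: closed_openC; exact: closed_closure.
move=> cq; have := open_nbhs_nbhs (conj oC cq); apply: filterS => z Cz.
by split=> // /subset_closure /Cz.
Qed.

Section Arcs.
Variables (sg : R) (Om : set (R * R)) (A : finType) (X Y : A -> R -> R) (l r : A -> R).
Hypotheses (oOm : open Om) (arcs : arc_boundary sg Om X Y l r).

(** The indicator of [Om] along the segment is locally constant; [clamp] makes it a function of all
    real parameters, as [locally_constant_eq] requires. *)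
Lemma vertical_segment (u v w : R) :
  (forall th, 0 <= th <= 1 -> ~ (closure Om `\` Om) (u, v - th * w)) ->
  Om (u, v) <-> Om (u, v - w).
Proof.
move=> nG.
pose f (th : R) : R := `[< Om (u, v - clamp 0 1 th * w) >]%:R.
have /(_ 0 1) : forall x y, f x = f y.
  apply: locally_constant_eq => th.
  have /(locally_constant_off_boundary oOm) H := nG _ (clamp_itv th ler01).
  have cv : (u, v - clamp 0 1 t * w) @[t --> th] --> (u, v - clamp 0 1 th * w).
    have cv2 : v - clamp 0 1 t * w @[t --> th] --> v - clamp 0 1 th * w.
      apply: cvgB; first exact: cvg_cst.
      by apply: cvgM; [exact: clamp_continuous|exact: cvg_cst].
    exact: (cvg_pair (cvg_cst u) cv2).
  have E : \forall t \near th, Om (u, v - clamp 0 1 t * w) <-> Om (u, v - clamp 0 1 th * w).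
    exact: (cv _ H).
  near=> t; rewrite /f; congr (nat_of_bool _)%:R; apply: asbool_equiv_eq.
  by near: t.
rewrite /f !clamp_id ?lexx ?ler01 // mul0r mul1r subr0.
have [Ov|nOv] := pselect (Om (u, v)); have [Ow|nOw] := pselect (Om (u, v - w)).
- by split.
- by rewrite (asboolT Ov) (asboolF nOw) => /eqP; rewrite oner_eq0.
- by rewrite (asboolF nOv) (asboolT Ow) => /esym/eqP; rewrite oner_eq0.
- by split.
Unshelve. all: by end_near. Qed.

(* Near the point itself this only uses that the tangent is not in the wedge
   spanned by the normal and the horizontal; elsewhere, compactness of the arcs. *)
Lemma wedge_off_boundary (a : A) (s0 : R) : l a < s0 < r a -> derive1 (Y a) s0 != 0 ->
  \forall h \near 0^', forall th, 0 <= th <= 1 ->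
  ~ (closure Om `\` Om) (X a s0 + h * derive1 (Y a) s0,
                         Y a s0 - th * (h * derive1 (X a) s0)).
Proof.
move=> s0lr b0.
set b := derive1 (Y a) s0; set c := derive1 (X a) s0.
pose Q e (h s : R) := forall th, 0 <= th <= 1 ->
  (X e s, Y e s) <> (X a s0 + h * b, Y a s0 - th * (h * c)).
have nearQ e : \forall h \near 0^', `[l e, r e]%classic `<=` Q e h.
  have /compact_near_coveringP nc := @segment_compact R (l e) (r e).
  apply: nc => s' /=; rewrite in_itv /= => s'lr.
  have [zz|zz] := pselect ((X e s', Y e s') = (X a s0, Y a s0)).
    have [-> ->] := arc_simple arcs s0lr s'lr zz.
    have [gX [gXE gXc gX0]] := C1_slope s0 (arc_C1X arcs a).
    have [gY [gYE gYc gY0]] := C1_slope s0 (arc_C1Y arcs a).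
    have b2 : 0 < b ^+ 2 by rewrite exprn_even_gt0.
    have H1 : \forall s \near s0, b ^+ 2 / 2 < b * gY s.
      have /cvgr_gt : b * gY z @[z --> s0] --> b * gY s0.
        by apply: cvgM; [exact: cvg_cst|exact: gYc].
      by apply; rewrite gY0 -/b -expr2; lra.
    have H2 : \forall s \near s0, - (b ^+ 2 / 2) < c * gX s.
      have /cvgr_gt : c * gX z @[z --> s0] --> c * gX s0.
        by apply: cvgM; [exact: cvg_cst|exact: gXc].
      by apply; rewrite gX0 -/c -expr2; have := sqr_ge0 c; lra.
    have H12 : \forall s \near s0, b ^+ 2 / 2 < b * gY s /\ - (b ^+ 2 / 2) < c * gX s.
      by near=> s; split; near: s.
    exists ([set s | b ^+ 2 / 2 < b * gY s /\ - (b ^+ 2 / 2) < c * gX s], [set h | h != 0]).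
      by split; [exact: H12|exact: withinT].
    move=> [s h] /= [[h1 h2] h0] th /andP[th0 th1] [].
    move=> /eqP; rewrite addrC -subr_eq gXE => /eqP EX.
    move=> /eqP; rewrite addrC -subr_eq gYE => /eqP EY.
    have hb : h * b != 0 by rewrite mulf_neq0.
    have t0 : s - s0 != 0 by apply: contraNneq hb => t0; rewrite -EX t0 mulr0.
    (* Eliminating [h] from the two coordinate equations gives this product. Its first factor is
       positive near [s0]: [b * gY s] exceeds [b ^+ 2 / 2], and [th <= 1] keeps the other summand
       above [- (b ^+ 2 / 2)]. *)
    have : (b * gY s + th * (c * gX s)) * (s - s0) = 0.
      rewrite mulrDl -!mulrA EX EY; ring.
    move/eqP; rewrite mulf_eq0 (negPf t0) orbF => /eqP E.
    nra.
  have [xx|xx] := eqVneq (X e s') (X a s0); last first.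
    pose eta := `|X e s' - X a s0| / 2.
    have eta0 : 0 < eta by rewrite divr_gt0 // normr_gt0 subr_eq0.
    have /cvgrPdist_lt /(_ _ eta0) H1 := C1_continuous (arc_C1X arcs e) (x := s').
    have /cvgr0Pnorm_lt /(_ _ eta0) H2 : h * b @[h --> 0^'] --> (0 : R).
      rewrite -[X in _ --> X](mul0r b); apply: cvgM; last exact: cvg_cst.
      exact: cvg_within.
    exists ([set s | `|X e s' - X e s| < eta], [set h | `|h * b| < eta]); first by split.
    move=> [s h] /= [h1 h2] th th01 [Ex _].
    have : `|X e s' - X a s0| < eta + eta.
      rewrite (_ : _ - _ = (X e s' - X e s) + h * b); last by rewrite Ex; ring.
      by rewrite (le_lt_trans (ler_normD _ _)) // ltrD.
    by rewrite -splitr ltxx.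
  have yy : Y e s' != Y a s0 by apply: contra_notN zz => /eqP <-; rewrite xx.
  pose eta := `|Y e s' - Y a s0| / 2.
  have eta0 : 0 < eta by rewrite divr_gt0 // normr_gt0 subr_eq0.
  have /cvgrPdist_lt /(_ _ eta0) H1 := C1_continuous (arc_C1Y arcs e) (x := s').
  have /cvgr0Pnorm_lt /(_ _ eta0) H2 : h * c @[h --> 0^'] --> (0 : R).
    rewrite -[X in _ --> X](mul0r c); apply: cvgM; last exact: cvg_cst.
    exact: cvg_within.
  exists ([set s | `|Y e s' - Y e s| < eta], [set h | `|h * c| < eta]); first by split.
  move=> [s h] /= [h1 h2] th /andP[th0 th1] [_ Ey].
  have : `|Y e s' - Y a s0| < eta + eta.
    rewrite (_ : _ - _ = (Y e s' - Y e s) - th * (h * c)); last by rewrite Ey; ring.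
    rewrite (le_lt_trans (ler_normB _ _)) // ltrD // (le_lt_trans _ h2) //.
    by rewrite normrM ger0_norm // ler_piMl.
  by rewrite -splitr ltxx.
have /filter_forall H := nearQ.
apply: filterS H => h Hh th th01; rewrite (arc_cover arcs) => -[e [s [slr E]]].
by apply: (Hh e s _ th th01 (esym E)); rewrite /= in_itv.
Unshelve. all: by end_near. Qed.

Definition slice Om (y : R) : set R := [set x | Om (x, y)].

(** The orientation hypothesis speaks of points on the normal, whereas the slice is horizontal. A
    point of the slice near the crossing is joined to the point of the normal with the same abscissa
    by a vertical segment that misses the boundary, so both lie on the same side. *)
Lemma slice_crossing (a : A) (s0 : R) : l a < s0 < r a -> derive1 (Y a) s0 != 0 ->
  crossing (slice Om (Y a s0)) (0 < sg * derive1 (Y a) s0) (X a s0).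
Proof.
move=> s0lr b0.
set b := derive1 (Y a) s0; set c := derive1 (X a) s0.
split.
  have : (closure Om `\` Om) (X a s0, Y a s0).
    rewrite (arc_cover arcs); exists a, s0; split => //.
    by have /andP[/ltW -> /ltW ->] := s0lr.
  by case.
have [e [e0 out]] := arc_outward arcs s0lr.
have [d /= d0 wd] := wedge_off_boundary s0lr b0.
have sg2 := arc_sg arcs.
pose m := Order.min e d.
have m0 : 0 < m by rewrite lt_min e0 d0.
(* The parameter [k] runs along [(b, -c)], which is [sg] times the outward normal; this is why the
   sign of [sg * k] decides. *)
have key (k : R) : k != 0 -> `|k| < m ->
    Om (X a s0 + k * b, Y a s0) <-> sg * k < 0.
  move=> k0; rewrite lt_min => /andP[ke kd].
  rewrite (@vertical_segment _ _ (k * c)); last first.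
    by move=> th th01; apply: wd => //=; rewrite sub0r normrN.
  have sg1 : `|sg| = 1.
    by apply/eqP; rewrite -(@eqrXn2 _ 2) ?normr_ge0 // -normrX sg2 expr1n normr1.
  have sgn0 : sg != 0 by rewrite -normr_eq0 sg1 oner_eq0.
  have kE : k = sg * (sg * k) by rewrite mulrA -expr2 sg2 mul1r.
  have nk : `|sg * k| < e by rewrite normrM sg1 mul1r.
  have [sk|sk|/eqP] := ltgtP (sg * k) 0; last by rewrite mulf_eq0 (negPf sgn0) (negPf k0).
    have /out[_ /=] : 0 < - (sg * k) < e by rewrite oppr_gt0 sk -(ltr0_norm sk).
    rewrite !mulNr opprK -!/b -!/c (_ : sg * k * (sg * b) = sg * (sg * k) * b); last by ring.
    rewrite (_ : sg * k * (sg * c) = sg * (sg * k) * c); last by ring.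
    by rewrite -!kE; split.
  have /out[/= + _] : 0 < (sg * k) < e by rewrite sk -(gtr0_norm sk).
  rewrite -!/b -!/c (_ : sg * k * (sg * b) = sg * (sg * k) * b); last by ring.
  rewrite (_ : sg * k * (sg * c) = sg * (sg * k) * c); last by ring.
  by rewrite -!kE; split.
exists (m * `|b|) => /=; first by rewrite mulr_gt0 ?normr_gt0.
move=> h /=; rewrite sub0r normrN => hm h0.
have hb : h / b != 0 by rewrite mulf_neq0 ?invr_eq0 // gt_eqF.
have nhb : `|h / b| < m by rewrite normrM normfV ltr_pdivrMr ?normr_gt0.
have sgb : (0 < sg * (h / b)) = (0 < sg * b).
  rewrite (_ : sg * (h / b) = (sg * b) * (h / b ^+ 2)); last by field.
  by rewrite pmulr_lgt0 // divr_gt0 // exprn_even_gt0.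
have := key (- (h / b)); have := key (h / b).
rewrite oppr_eq0 normrN mulNr divfK // mulrN oppr_lt0 /slice /= sgb.
move=> /(_ hb nhb) K1 /(_ hb nhb) K2; split=> //; rewrite K1 -sgb -leNgt le_eqVlt.
split=> [->|]; first by rewrite orbT.
case/predU1P => // /eqP; rewrite mulf_eq0 (negPf hb) orbF => /eqP sg0.
by move: sg2; rewrite sg0 expr0n /= => /eqP; rewrite eq_sym oner_eq0.
Qed.
End Arcs.
End Geometry.

(** * Fubini for bounded functions with bounded support *)

Section Boxed.
Variable R : realType.
Local Notation mu := (@lebesgue_measure R).
Local Notation R2 := (measurableTypeR R * measurableTypeR R)%type.

(** Measurability refers to the product sigma-algebra, so the open set is written as a countable
    union of products of balls with rational centres and radii. *)
Lemma open_measurable2 (U : set (R * R)) : open U -> measurable (U : set R2).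
Proof.
move=> oU.
pose B (q : (rat * rat) * (rat * rat)) : set (R * R) :=
  ball (ratr q.1.1 : R) (ratr q.1.2 : R) `*` ball (ratr q.2.1 : R) (ratr q.2.2 : R).
pose F q : set R2 := if `[< B q `<=` U >] then B q else set0.
have -> : U = \bigcup_q F q.
  apply/seteqP; split=> [[x y] Uxy|z [q _]]; last by rewrite /F; case: asboolP => // + Bz; exact.
  have /= [[V W] /= [Vx Wy] VW] := open_nbhs_nbhs (conj oU Uxy).
  have [c1 [r1 [/set_mem B1 S1]]] := @open_subball_rat R _ x (open_interior V) (mem_set Vx).
  have [c2 [r2 [/set_mem B2 S2]]] := @open_subball_rat R _ y (open_interior W) (mem_set Wy).
  exists ((c1, r1), (c2, r2)) => //; rewrite /F asboolT //.
  move=> [x' y'] [/= /S1 /interior_subset V' /S2 /interior_subset W'].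
  exact: VW.
apply: countable_bigcupT_measurable => // q.
rewrite /F; case: asboolP => // _.
by apply: measurableX; apply: measurable_realfun.measurable_ball.
Qed.

(** Unlike integrability, these conditions make every section integrable, so the iterated integrals
    are free of exceptional null sets. *)
Record boxed (M : R) (f : R * R -> R) : Prop := {
  boxed_meas : measurable_fun setT (f : R2 -> R);
  boxed_bound : exists K, forall z, `|f z| <= K;
  boxed_supp : forall z, f z != 0 -> `|z.1| < M /\ `|z.2| < M }.

Lemma bounded_support_integrable d (T : measurableType d) (m : measure T R)
    (A : set T) (f : T -> R) : measurable A -> (m A < +oo)%E ->
  measurable_fun setT f -> (exists K, forall z, `|f z| <= K) ->
  (forall z, f z != 0 -> A z) -> m.-integrable setT (EFin \o f).
Proof.
move=> mA fA mf [K fK] fA0.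
have fE : EFin \o f = (EFin \o f) \_ A.
  apply/funext => z; rewrite patchE; case: ifPn => // /negP zA.
  have [/= ->//|/fA0 Az] := eqVneq (f z) 0.
  by case: zA; exact: mem_set.
rewrite fE; apply: (integrable_mkcond (EFin \o f) mA).1.
apply: measurable_bounded_integrable => //; first exact: measurable_funTS.
by exists K; split=> [|x Kx z _ /=]; [exact: num_real|exact: le_trans (fK z) (ltW Kx)].
Qed.

Variables (M : R) (f : R * R -> R).
Hypothesis bf : boxed M f.

Lemma itv_ltNr (x : R) : `|x| < M -> (`]- M, M[%classic : set (measurableTypeR R)) x.
Proof. by rewrite /= in_itv /= ltr_norml. Qed.

Lemma itv_finite : (mu `](- M)%R, M[%classic < +oo)%E.
Proof. by rewrite lebesgue_measure_itv /=; case: ifP => _; rewrite ltry. Qed.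

Lemma boxed_integrable : (mu \x mu)%E.-integrable setT (EFin \o f).
Proof.
refine (@bounded_support_integrable _ R2 _
  ((`]- M, M[%classic : set (measurableTypeR R)) `*` (`]- M, M[%classic : set (measurableTypeR R))) f _ _ _ _ _).
- exact: measurableX.
- rewrite [X in (X < _)%E](_ : _ = (mu `](- M)%R, M[%classic * mu `](- M)%R, M[%classic)%E).
    by rewrite lte_mul_pinfty ?measure_ge0 ?itv_finite // ge0_fin_numE ?measure_ge0 ?itv_finite.
  by apply: product_measure1E; exact: measurable_itv.
- exact: boxed_meas bf.
- exact: boxed_bound bf.
- by move=> z /(boxed_supp bf)[z1 z2]; split; apply: itv_ltNr.
Qed.

Lemma boxed_integrable1 (y : R) : mu.-integrable setT (EFin \o (fun x => f (x, y))).
Proof.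
refine (@bounded_support_integrable _ (measurableTypeR R) _ `]- M, M[%classic _ _ _ _ _ _).
- exact: measurable_itv.
- exact: itv_finite.
- by have /(measurable_fun_pair1 (y : measurableTypeR R)) := boxed_meas bf.
- by have [K fK] := boxed_bound bf; exists K.
- by move=> x /(boxed_supp bf)[z1 _]; exact: itv_ltNr.
Qed.

Lemma boxed_integrable2 (x : R) : mu.-integrable setT (EFin \o (fun y => f (x, y))).
Proof.
refine (@bounded_support_integrable _ (measurableTypeR R) _ `]- M, M[%classic _ _ _ _ _ _).
- exact: measurable_itv.
- exact: itv_finite.
- by have /(measurable_fun_pair2 (x : measurableTypeR R)) := boxed_meas bf.
- by have [K fK] := boxed_bound bf; exists K.
- by move=> y /(boxed_supp bf)[_ z2]; exact: itv_ltNr.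
Qed.

Lemma boxed_fubini_F : EFin \o (fun x => \int[mu]_y f (x, y)) = fubini_F (T1 := measurableTypeR R) mu (EFin \o f).
Proof.
apply/funext => x; rewrite /= /fubini_F /Rintegral fineK //.
by have := integrable_fin_num _ (boxed_integrable2 x); apply.
Qed.

Lemma boxed_fubini_G : EFin \o (fun y => \int[mu]_x f (x, y)) = fubini_G (T2 := measurableTypeR R) mu (EFin \o f).
Proof.
apply/funext => y; rewrite /= /fubini_G /Rintegral fineK //.
by have := integrable_fin_num _ (boxed_integrable1 y); apply.
Qed.

Lemma boxed_Rintegral1 : \int[mu]_x \int[mu]_y f (x, y) = \int[(mu \x mu)%E]_z f z.
Proof.
rewrite /Rintegral -(integral12_prod_meas1 boxed_integrable) -boxed_fubini_F.
by [].
Qed.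

Lemma boxed_Rintegral2 : \int[mu]_y \int[mu]_x f (x, y) = \int[(mu \x mu)%E]_z f z.
Proof.
rewrite /Rintegral -(integral21_prod_meas1 boxed_integrable) -boxed_fubini_G.
by [].
Qed.

Lemma boxed_section_integrable1 :
  mu.-integrable setT (EFin \o (fun x => \int[mu]_y f (x, y))).
Proof. by rewrite boxed_fubini_F; exact: integrable_fubini_F boxed_integrable. Qed.

End Boxed.

Section BoxedSwap.
Variable R : realType.
Local Notation mu := (@lebesgue_measure R).

Lemma boxed_swap (M : R) (f : R * R -> R) : boxed M f -> boxed M (fun z => f (z.2, z.1)).
Proof.
move=> bf; split.
- have := measurableT_comp (boxed_meas bf) (@measurable_swap _ _ (measurableTypeR R) (measurableTypeR R)); exact.
- by have [K fK] := boxed_bound bf; exists K => z.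
- by move=> z /(boxed_supp bf)[].
Qed.

Lemma boxed_section_integrable2 (M : R) (f : R * R -> R) : boxed M f ->
  mu.-integrable setT (EFin \o (fun y => \int[mu]_x f (x, y))).
Proof. by move/boxed_swap/boxed_section_integrable1. Qed.
End BoxedSwap.

(** * The integral along an arc as an integral over heights *)

Section ArcIntegral.
Variable R : realType.
Local Notation mu := (@lebesgue_measure R).
Local Notation R2 := (measurableTypeR R * measurableTypeR R)%type.

Lemma Rintegral_indic d (T : measurableType d) (m : measure T R) (D : set T) (f : T -> R) :
  \int[m]_(x in D) f x = \int[m]_x (\1_D x * f x).
Proof.
rewrite Rintegral_mkcond; apply: eq_Rintegral => x _.
by rewrite patchE indicE; case: ifP => _; rewrite ?mul1r ?mul0r.
Qed.

Lemma indic_bound (T : Type) (D : set T) (x : T) : `|\1_D x : R| <= 1.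
Proof. by rewrite indicE ger0_norm ?ler0n // lern1 leq_b1. Qed.

Lemma indic_neq0 (T : Type) (D : set T) (x : T) : (\1_D x : R) != 0 -> D x.
Proof. by rewrite indicE pnatr_eq0 eqb0 negbK => /set_mem. Qed.

Lemma continuous_segment_bound (f : R -> R) (a b : R) : continuous f ->
  exists2 K, 0 < K & forall x, a <= x <= b -> `|f x| < K.
Proof.
move=> cf.
have [K [_ HK]] := compact_bounded (continuous_compact (continuous_subspaceT cf)
  (@segment_compact R a b)).
exists (`|K| + 2) => [|x xab]; first by rewrite ltr_wpDl.
have /HK : K < `|K| + 1 by rewrite (le_lt_trans (ler_norm K)) // ltrDl.
move=> /(_ (f x)) /= H; apply: le_lt_trans (H _) _.
  by exists x => //; rewrite in_itv.
by rewrite ltrD2l ltr1n.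
Qed.

(* For a regular value [y] this is the signed sum of [phi] over the crossings of
   the arc with the line of height [y] (see [level_integral]); in this form it is
   integrable in [y] without any control on the number of crossings. *)
Definition arc_level (Y phi : R -> R) (l r y : R) : R :=
  (y < Y r)%R%:R * phi r - (y < Y l)%R%:R * phi l -
  \int[mu]_(s in `[l, r]) ((y < Y s)%R%:R * (derive1 phi) s).

Lemma open_subgraph (f : R -> R) : continuous f -> open [set w : R * R | w.1 < f w.2].
Proof.
move=> cf; have -> : [set w : R * R | w.1 < f w.2] =
    (fun w : R * R => f w.2 - w.1) @^-1` [set t | 0 < t].
  by apply/funext => w /=; rewrite subr_gt0.
have cg : continuous (fun w : R * R => f w.2 - w.1).
  move=> w; apply: cvgB; last exact: cvg_fst.
  by apply: continuous_comp; [exact: cvg_snd|exact: cf].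
by move/continuousP: cg; apply; exact: open_gt.
Qed.

Lemma C1_cst (c : R) : C1 (fun=> c : R).
Proof.
have d0 : derive1 (fun=> c : R) = cst 0 by apply/funext => x; exact: derive1_cst.
by split=> [x|]; [exact: derivable_cst|rewrite d0 => x; exact: cvg_cst].
Qed.

Lemma derive1_idE : derive1 (id : R -> R) = cst 1.
Proof. by apply/funext => x; exact: derive1_id. Qed.

Lemma C1_id : C1 (id : R -> R).
Proof. by split=> [x|]; [exact: derivable_id|rewrite derive1_idE => x; exact: cvg_cst]. Qed.

Lemma below_integral (a M : R) : `|a| < M ->
  mu.-integrable `[- M, M] (EFin \o (fun y => (y < a)%R%:R)) /\
  \int[mu]_(y in `[- M, M]) (y < a)%R%:R = a + M.
Proof.
move=> aM.
have -> : (fun y => (y < a)%R%:R : R) =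
    (fun y => (side true a y)%:R * derive1 (id : R -> R) y).
  by apply/funext => y; rewrite derive1_idE mulr1.
split; first by apply: side_integrable; exact: C1_id.2.
by rewrite (side_integral true C1_id) ?opprK // -ltr_norml.
Qed.

Variables (Y phi : R -> R) (l r M : R).
Hypotheses (CY : C1 Y) (Cphi : C1 phi) (lr : l < r).
Hypotheses (YM : forall s, l <= s <= r -> `|Y s| < M) (lM : `|l| < M) (rM : `|r| < M).

(** The first coordinate is a height, the second a parameter of the arc. Integrating over the
    parameter gives the integral term of [arc_level]; integrating over the height gives the
    derivative of [phi] times [Y + M]. *)
Let g (z : R * R) : R := \1_(`[- M, M]%classic) z.1 *
  (\1_(`[l, r]%classic) z.2 * (\1_[set w : R * R | w.1 < Y w.2] z * (derive1 phi) z.2)).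

(** The support reaches the ends of the closed interval of heights, while [boxed] asks for strict
    bounds; hence [M + 1]. *)
Let g_boxed : boxed (M + 1) g.
Proof.
have M0 : 0 < M by exact: le_lt_trans lM.
split.
- have m1 (i : interval R) : measurable_fun setT (\1_[set` i] : measurableTypeR R -> R).
    by apply: measurable_indic; exact: measurable_itv.
  have m3 : measurable_fun setT (\1_[set w : R * R | w.1 < Y w.2] : R2 -> R).
    by apply: measurable_indic; apply: open_measurable2; exact: open_subgraph (C1_continuous CY).
  have m4 : measurable_fun setT (derive1 phi : measurableTypeR R -> R).
    by apply: continuous_measurable_fun; exact: Cphi.2.
  apply: measurable_funM; first exact: (measurableT_comp (m1 _) measurable_fst).
  apply: measurable_funM; first exact: (measurableT_comp (m1 _) measurable_snd).
  apply: measurable_funM => //; exact: (measurableT_comp m4 measurable_snd).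
- have [K K0 HK] := continuous_segment_bound l r Cphi.2.
  exists K => z; rewrite /g normrM -[leRHS]mul1r ler_pM ?indic_bound //.
  rewrite mulrCA normrM -[leRHS]mul1r ler_pM ?indic_bound // normrM.
  rewrite indicE; case: (boolP (_ \in _)); last by rewrite normr0 mul0r ltW.
  by move=> /set_mem /=; rewrite in_itv /= => /HK /ltW; rewrite normr1 mul1r.
- move=> z; rewrite !mulf_eq0 !negb_or => /and4P[h1 h2 _ _].
  move: (indic_neq0 h1) (indic_neq0 h2) => /=; rewrite !in_itv /=.
  move=> /andP[z1 z1'] /andP[z2 z2']; split.
    by rewrite ltr_norml; apply/andP; split; lra.
  have /andP[l1 l2] : - M < l < M by rewrite -ltr_norml.
  have /andP[r1 r2] : - M < r < M by rewrite -ltr_norml.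
  by rewrite ltr_norml; apply/andP; split; lra.
Qed.

Let J (y : R) := \int[mu]_(s in `[l, r]) ((y < Y s)%R%:R * (derive1 phi) s).

Let gJ y : \int[mu]_s g (y, s) = \1_(`[- M, M]%classic) y * J y.
Proof.
rewrite /J [in RHS]Rintegral_indic /g /= [in RHS]indicE.
have [yM|yM] := boolP (_ \in _); last first.
  rewrite mul0r (eq_Rintegral mu (g := cst 0)) ?Rintegral_cst ?mul0r // => s _.
  by rewrite indicE (negbTE yM) mul0r.
rewrite mul1r; apply: eq_Rintegral => s _; rewrite indicE yM mul1r.
congr (_ * (_ * _)); rewrite indicE; congr (nat_of_bool _)%:R.
by apply/idP/idP; rewrite inE.
Qed.

Let gY s : \int[mu]_y g (y, s) = \1_(`[l, r]%classic) s * ((derive1 phi) s * (Y s + M)).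
Proof.
rewrite /g /= [in RHS]indicE.
have [slr|slr] := boolP (_ \in _); last first.
  rewrite mul0r (eq_Rintegral mu (g := cst 0)) ?Rintegral_cst ?mul0r // => y _.
  by rewrite [X in _ * (X * _)]indicE (negbTE slr) mul0r mulr0.
have [|bi bE] := @below_integral (Y s) M.
  by apply: YM; move: slr; rewrite inE /= in_itv.
rewrite mul1r -bE mulrC -RintegralZr // [RHS]Rintegral_indic.
apply: eq_Rintegral => y _; congr (_ * _); rewrite [X in X * _]indicE slr mul1r.
congr (_ * _); rewrite indicE; congr (nat_of_bool _)%:R.
by apply/idP/idP; rewrite inE.
Qed.

(** Fubini turns the integral term of [arc_level] into the integral of the derivative of [phi] times
    [Y + M]; the end terms integrate to the boundary values of [phi * (Y + M)]. Integration by parts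
    with the antiderivative [Y + M] then leaves [phi] times the derivative of [Y]. *)
Lemma arc_integral : mu.-integrable `[- M, M] (EFin \o arc_level Y phi l r) /\
  \int[mu]_(s in `[l, r]) (phi s * (derive1 Y) s) = \int[mu]_(y in `[- M, M]) arc_level Y phi l r y.
Proof.
have llr : l <= l <= r by rewrite lexx ltW.
have rlr : l <= r <= r by rewrite lexx ltW.
have mI : measurable (`[- M, M]%classic : set (measurableTypeR R)) by exact: measurable_itv.
have Jint : mu.-integrable `[- M, M] (EFin \o J).
  have := integrableS measurableT mI (@subsetT _ _) (boxed_section_integrable1 g_boxed).
  apply: eq_integrable => // y /set_mem yM /=.
  by rewrite gJ indicE mem_set // mul1r.
have [ir Er] := below_integral (YM rlr).
have [il El] := below_integral (YM llr).
have ir' : mu.-integrable `[- M, M] (EFin \o (fun y => (y < Y r)%R%:R * phi r)).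
  by have := integrableZr mI (phi r) ir; apply.
have il' : mu.-integrable `[- M, M] (EFin \o (fun y => (y < Y l)%R%:R * phi l)).
  by have := integrableZr mI (phi l) il; apply.
have irl : mu.-integrable `[- M, M] (EFin \o (fun y => (y < Y r)%R%:R * phi r - (y < Y l)%R%:R * phi l)).
  by have := integrableB mI ir' il'; apply.
split; first by have := integrableB mI irl Jint; apply.
rewrite /arc_level RintegralB // RintegralB // RintegralZr // RintegralZr // Er El.
have -> : \int[mu]_(y in `[- M, M]) J y =
    \int[mu]_(s in `[l, r]) ((derive1 phi) s * (Y s + M)).
  rewrite [LHS]Rintegral_indic; under eq_Rintegral do rewrite -gJ.
  rewrite (boxed_Rintegral1 g_boxed) -(boxed_Rintegral2 g_boxed) [RHS]Rintegral_indic.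
  by apply: eq_Rintegral => s _; rewrite gY.
have dYM s : derivable (fun s => Y s + M) s 1.
  by apply: derivableD; [exact: CY.1|exact: derivable_cst].
have YM' : derive1 (fun s => Y s + M) = derive1 Y.
  by apply/funext => s; rewrite !derive1E deriveD ?derive_cst ?addr0 //; exact: CY.1.
have CYM : C1 (fun s => Y s + M) by split; [exact: dYM|rewrite YM'; exact: CY.2].
have -> : \int[mu]_(s in `[l, r]) (phi s * (derive1 Y) s) =
    phi r * (Y r + M) - phi l * (Y l + M) -
    \int[mu]_(s in `[l, r]) ((derive1 phi) s * (Y s + M)).
  apply: (Rintegration_by_parts (G := fun s => Y s + M) lr).
  - by apply: continuous_subspaceT; exact: Cphi.2.
  - exact: C1_LRcontinuous.
  - by move=> s _.
  - by apply: continuous_subspaceT; exact: CY.2.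
  - exact: C1_LRcontinuous.
  - by move=> s _; rewrite YM'.
by ring.
Qed.
End ArcIntegral.

(** * Green's formula *)

Section Green.
Variable R : realType.
Local Notation mu := (@lebesgue_measure R).
Local Notation R2 := (measurableTypeR R * measurableTypeR R)%type.

Lemma ae_eq_Rintegral d (T : measurableType d) (m : measure T R) (D : set T) (f g : T -> R) :
  measurable D -> m.-integrable D (EFin \o f) -> m.-integrable D (EFin \o g) ->
  (\forall x \ae m, D x -> f x = g x) ->
  \int[m]_(x in D) f x = \int[m]_(x in D) g x.
Proof.
move=> mD /integrableP[mf _] /integrableP[mg _] fg; congr fine.
apply: ae_eq_integral => //; apply: filterS fg => x fg Dx.
by rewrite /= fg.
Qed.

Lemma Rintegral_support d (T : measurableType d) (m : measure T R) (D : set T) (f : T -> R) :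
  (forall x, f x != 0 -> D x) -> \int[m]_(x in D) f x = \int[m]_x f x.
Proof.
move=> fD; rewrite Rintegral_indic; apply: eq_Rintegral => x _.
have [->|/fD Dx] := eqVneq (f x) 0; first by rewrite mulr0.
by rewrite indicE mem_set // mul1r.
Qed.

Lemma continuous_measurable2 (h : R * R -> R) : continuous h ->
  measurable_fun setT (h : R2 -> R).
Proof.
move=> /continuousP ch; apply: (measurability _ (RGenOpens.measurableE R)).
move=> _ [_ [a [b ->] <-]]; rewrite setTI; apply: open_measurable2.
exact/ch/interval_open.
Qed.

Lemma continuous_box_bound (h : R * R -> R) (M : R) : continuous h ->
  exists2 K, 0 < K & forall z, `|z.1| < M -> `|z.2| < M -> `|h z| < K.
Proof.
move=> ch.
have cB := compact_setX (@segment_compact R (- M) M) (@segment_compact R (- M) M).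
have [K [_ HK]] := compact_bounded (continuous_compact (continuous_subspaceT ch) cB).
exists (`|K| + 2) => [|z z1 z2]; first by rewrite ltr_wpDl.
have /HK : K < `|K| + 1 by rewrite (le_lt_trans (ler_norm K)) // ltrDl.
move=> /(_ (h z)) /= H; apply: le_lt_trans (H _) _; last by rewrite ltrD2l ltr1n.
exists z => //; split; rewrite /= in_itv /=.
  by move: z1; rewrite ltr_norml => /andP[/ltW -> /ltW ->].
by move: z2; rewrite ltr_norml => /andP[/ltW -> /ltW ->].
Qed.

Variables (sg : R) (Om : set (R * R)) (A : finType) (X Y : A -> R -> R) (l r : A -> R).
Hypotheses (oOm : open Om) (arcs : arc_boundary sg Om X Y l r).
Variables (F : R -> R -> R).
(** Regularity of [F] is stated through composition with C1 functions: it yields both the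
    restriction to a horizontal line and the restriction to an arc, without differentiability in two
    variables. *)
Hypothesis FC1 : forall f g, C1 f -> C1 g -> C1 (fun s => F (f s) (g s)).
Hypothesis Fx_continuous : continuous (fun z : R * R => derive1 (F^~ z.2) z.1).

Let phi (a : A) (s : R) := F (X a s) (Y a s).

Let C1phi a : C1 (phi a).
Proof. by apply: FC1; [exact: arc_C1X arcs a|exact: arc_C1Y arcs a]. Qed.

Let C1F y : C1 (F^~ y).
Proof. exact: (FC1 (@C1_id R) (C1_cst y)). Qed.

Variable M : R.
Hypothesis OmM : forall z, Om z -> `|z.1| < M /\ `|z.2| < M.
Hypothesis lM : forall a, `|l a| < M.
Hypothesis rM : forall a, `|r a| < M.
Hypothesis XM : forall a s, l a <= s <= r a -> `|X a s| < M.
Hypothesis YM : forall a s, l a <= s <= r a -> `|Y a s| < M.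

(** Both sides are signed sums of [F] over the same crossings: the left one by [crossing_integral]
    on the slice, the right one by [level_integral] on each arc. *)
Lemma slice_integral_arcs y : (forall a, regular_value (Y a) (l a) (r a) y) -> 0 < M ->
  \int[mu]_(x in `[- M, M]) (\1_Om (x, y) * derive1 (F^~ y) x) =
  sg * \sum_a arc_level (Y a) (fun s => F (X a s) (Y a s)) (l a) (r a) y.
Proof.
move=> reg M0.
have /choice[P HP] a := finite_roots (arc_C1Y arcs a) (arc_lr arcs a) (reg a).
have HP1 a := (HP a).1; have HP2 a := (HP a).2.
have interior a s : l a <= s <= r a -> Y a s = y -> s \in P a.
  move=> slr Ys; rewrite HP2 Ys eqxx andbT; have [yl yr _] := reg a.
  have /andP[ls sr] := slr; rewrite !lt_neqAle ls sr !andbT; apply/andP; split.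
    by apply: contra_neq yl => ->; rewrite Ys.
  by apply: contra_neq yr => <-; rewrite Ys.
have level a : arc_level (Y a) (phi a) (l a) (r a) y =
    \sum_(s <- P a) (-1) ^+ (derive1 (Y a) s < 0)%R * phi a s.
  rewrite /arc_level (level_integral (arc_C1Y arcs a) (C1phi a) (arc_lr arcs a)
    (reg a) (HP1 a) (HP2 a)).
  by ring.
under [in RHS]eq_bigr do rewrite level.
(* The crossings of all arcs with the line of height [y], as pairs of an arc and a parameter. *)
pose PP := [seq (a, s) | a <- enum A, s <- P a].
pose p (t : A * R) := X t.1 t.2.
pose b (t : A * R) := (0 < sg * derive1 (Y t.1) t.2)%R.
have PPE t : t \in PP -> [/\ l t.1 < t.2 < r t.1, Y t.1 t.2 = y & derive1 (Y t.1) t.2 != 0].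
  move=> /allpairsPdep[a [s [_ + ->]]] /=; rewrite HP2 => /andP[slr /eqP Ys].
  split=> //; have [_ _] := reg a; apply=> //.
  by have /andP[/ltW -> /ltW ->] := slr.
have sign (d : R) : d != 0 -> (-1) ^+ (~~ (0 < sg * d)%R) = sg * (-1) ^+ (d < 0)%R :> R.
  have : sg ^+ 2 == 1 by rewrite (arc_sg arcs).
  rewrite sqrf_eq1 neq_lt => /orP[] /eqP -> /orP[] d0.
  - by rewrite !mul1r d0 (lt_gtF d0).
  - by rewrite !mul1r d0 (lt_gtF d0).
  - by rewrite !mulN1r oppr_gt0 d0 expr0 expr1 opprK.
  - by rewrite !mulN1r oppr_gt0 (lt_gtF d0) expr0 expr1.
have PP_uniq : uniq PP.
  apply: allpairs_uniq_dep => [|a _|[a s] [a' s'] _ _ /= E]; first exact: enum_uniq.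
    exact: HP1.
  by move: E => [-> ->].
have p_inj : {in PP &, injective p}.
  move=> [a s] [a' s'] /PPE[/= slr Ys _] /PPE[/= slr' Ys' _]; rewrite /p /= => EX.
  have slr'' : l a' <= s' <= r a' by have /andP[/ltW -> /ltW ->] := slr'.
  by have [|-> ->] := arc_simple arcs slr slr''; first by rewrite EX Ys Ys'.
have slice_const x : (forall t, t \in PP -> x != p t) ->
    \forall x' \near x, slice Om y x' <-> slice Om y x.
  move=> xP.
  have /(locally_constant_off_boundary oOm) H : ~ (closure Om `\` Om) (x, y).
    rewrite (arc_cover arcs) => -[a [s [slr [xE yE]]]].
    have sP := interior a s slr (esym yE).
    have /xP : (a, s) \in PP by apply/allpairsPdep; exists a, s; rewrite mem_enum.
    by rewrite /p /= xE eqxx.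
  have c : (x', y) @[x' --> x] --> (x, y) by exact: (cvg_pair cvg_id (cvg_cst y)).
  exact: c _ H.
have cross t : t \in PP -> crossing (slice Om y) (b t) (p t).
  by move=> /PPE[slr <- d0]; have := slice_crossing oOm arcs slr d0.
have pM t : t \in PP -> - M < p t < M.
  by move=> /PPE[/andP[/ltW ls /ltW sr] _ _]; rewrite -ltr_norml XM // ls.
have := crossing_integral (gtrN M0) (C1F y) PP_uniq p_inj slice_const cross pM.
(* The end terms vanish because [Om] lies strictly inside the box. *)
have out x : `|x| = M -> \1_(slice Om y) x = 0 :> R.
  move=> xM; rewrite indicE; case: (boolP (x \in _)) => // /set_mem /OmM [/=].
  by rewrite xM ltxx.
rewrite !out ?normrN ?gtr0_norm // !mul0r subrr add0r /PP big_allpairs_dep big_enum /=.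
rewrite mulr_sumr => E; rewrite (eq_Rintegral mu (g := fun x => \1_(slice Om y) x * derive1 (F^~ y) x)).
  rewrite E; apply: eq_bigr => a _; rewrite mulr_sumr big_seq [RHS]big_seq.
  apply: eq_bigr => s sP.
  have /PPE[/= _ Ys d0] : (a, s) \in PP by apply/allpairsPdep; exists a, s; rewrite mem_enum.
  rewrite mulrA /phi Ys /b /p /=; congr (_ * _).
  exact: sign.
by move=> x _; rewrite !indicE.
Qed.

Lemma indic_mul_boxed (h : R * R -> R) : continuous h -> boxed M (fun z => \1_Om z * h z).
Proof.
move=> ch; split.
- apply: measurable_funM; last exact: continuous_measurable2.
  by apply: measurable_indic; exact: open_measurable2.
- have [K K0 HK] := continuous_box_bound M ch.
  exists K => z; rewrite indicE; case: (boolP (z \in Om)) => [/set_mem /OmM [z1 z2]|_].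
    by rewrite mul1r ltW // HK.
  by rewrite mul0r normr0 ltW.
- by move=> z; rewrite mulf_eq0 negb_or => /andP[z0 _]; exact: OmM (indic_neq0 z0).
Qed.

(** Almost every height is regular for all of the finitely many arcs at once, so
    [slice_integral_arcs] can be integrated over the heights and [arc_integral] applied to each
    arc. *)
Lemma green_arcs : 0 < M ->
  \int[mu]_y \int[mu]_x (\1_Om (x, y) * derive1 (F^~ y) x) =
  sg * \sum_a \int[mu]_(s in `[l a, r a]) (F (X a s) (Y a s) * derive1 (Y a) s).
Proof.
move=> M0.
pose f (z : R * R) : R := \1_Om z * derive1 (F^~ z.2) z.1.
have bf : boxed M f by exact: indic_mul_boxed.
have arcI a := arc_integral (arc_C1Y arcs a) (C1phi a) (arc_lr arcs a) (@YM a) (lM a) (rM a).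
have mI : measurable (`[- M, M]%classic : set (measurableTypeR R)) by exact: measurable_itv.
have inI (t : R) : `|t| < M -> (`[- M, M]%classic : set R) t.
  by rewrite /= in_itv /= ltr_norml => /andP[/ltW -> /ltW ->].
have f1 y : \int[mu]_(x in `[- M, M]) f (x, y) = \int[mu]_x f (x, y).
  by apply: Rintegral_support => x /(boxed_supp bf)[/inI].
have f2 : \int[mu]_(y in `[- M, M]) \int[mu]_x f (x, y) = \int[mu]_y \int[mu]_x f (x, y).
  apply: Rintegral_support => y; apply: contra_neqP => yM.
  rewrite (eq_Rintegral mu (g := cst 0)) ?Rintegral_cst ?mul0r // => x _ /=.
  by apply/eqP; apply: contra_notT yM => /(boxed_supp bf)[_ /inI].
have [sint sE] := Rintegral_sum (enum A) mI (fun a => (arcI a).1).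
have sint' : mu.-integrable `[- M, M] (EFin \o (fun y =>
    sg * \sum_(a <- enum A) arc_level (Y a) (phi a) (l a) (r a) y)).
  by have := integrableZl mI sg sint; apply.
transitivity (\int[mu]_(y in `[- M, M])
    (sg * \sum_(a <- enum A) arc_level (Y a) (phi a) (l a) (r a) y)).
  rewrite -[LHS]f2; apply: ae_eq_Rintegral => //.
    by have := integrableS measurableT mI (@subsetT _ _) (boxed_section_integrable2 bf).
  have : \forall y \ae mu, forall a, regular_value (Y a) (l a) (r a) y.
    apply: (filter_forall (ae_filter_ringOfSetsType mu)) => a.
    exact: regular_value_ae (arc_C1Y arcs a) (arc_lr arcs a).
  apply: (@filterS _ _ (ae_filter_ringOfSetsType mu)) => y reg _.
  by rewrite -f1 /f /= (slice_integral_arcs reg M0) big_enum.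
rewrite RintegralZl // sE big_enum; congr (_ * _).
by apply: eq_bigr => a _; rewrite (arcI a).2.
Qed.
End Green.

(** * Cutting the boundary curves into C1 arcs *)

Section Pieces.
Variable R : realType.
Local Notation mu := (@lebesgue_measure R).

Lemma integrable_disjoint_union (D E : set (measurableTypeR R)) (f : R -> R) :
  measurable D -> measurable E -> [disjoint D & E] ->
  mu.-integrable D (EFin \o f) -> mu.-integrable E (EFin \o f) ->
  mu.-integrable (D `|` E) (EFin \o f).
Proof.
move=> mD mE /disj_set2P DE /(integrable_mkcond _ mD) iD /(integrable_mkcond _ mE) iE.
apply/integrable_mkcond; first exact: measurableU.
have := integrableD measurableT iD iE; apply: eq_integrable => // x _ /=.
rewrite !patchE in_setU; have [xD|] := boolP (x \in D); have [xE|] := boolP (x \in E) => //=.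
- by have := conj (set_mem xD) (set_mem xE); rewrite -[_ /\ _]/((D `&` E) x) DE.
- by rewrite adde0.
- by rewrite add0e.
- by rewrite adde0.
Qed.

(** Meant for integrands containing the derivative of a boundary curve, which is uncontrolled at
    break points; the two end points are a null set. *)
Lemma integral_piece (k k' : R -> R) (a b : R) : continuous k' -> a < b ->
  {in `]a, b[, k =1 k'} ->
  mu.-integrable `[a, b] (EFin \o k) /\
  \int[mu]_(x in `[a, b]) k x = \int[mu]_(x in `[a, b]) k' x.
Proof.
move=> ck' ab kk'.
have mk' : measurable_fun `]a, b[ k'.
  by apply: measurable_funTS; exact: continuous_measurable_fun.
have mk : measurable_fun `]a, b[ k.
  by apply: eq_measurable_fun mk' => x /set_mem xab; rewrite kk'.
split.
  have mN : measurable ([set a] `|` [set b] : set (measurableTypeR R)) by exact: measurableU.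
  have mI : measurable (`[a, b]%classic : set (measurableTypeR R)) by exact: measurable_itv.
  have mk2 : measurable_fun (`[a, b]%classic : set (measurableTypeR R)) (EFin \o k).
    by apply/measurable_EFinP; exact: measurable_fun_itv_cc mk.
  have N0 : mu ([set a] `|` [set b]) = 0.
    by apply: null_set_setU => //; exact: lebesgue_measure_set1.
  apply: (negligible_integrable mN mI mk2 N0).2.
  have ik' := continuous_integrable a b ck'.
  have : mu.-integrable (`[a, b]%classic `\` ([set a] `|` [set b])) (EFin \o k').
    by apply: integrableS mI _ _ ik'; [exact: measurableD|move=> x []].
  apply: eq_integrable => [|x /set_mem[/=]].
    exact: measurableD.
  rewrite in_itv /= => /andP[ax xb] /not_orP[/= xa xb']; rewrite kk' //.
  by rewrite in_itv /= !lt_neqAle ax xb !andbT; apply/andP; split; apply/eqP => // /esym.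
have E h : measurable_fun `]a, b[ h ->
    (\int[mu]_(x in `[a, b]) (h x)%:E = \int[mu]_(x in `]a, b[) (h x)%:E)%E.
  by move=> mh; apply: integral_itv_bndoo; exact/measurable_EFinP.
rewrite /Rintegral (E _ mk) (E _ mk').
by congr fine; apply: eq_integral => x /set_mem xab; rewrite kk'.
Qed.

Lemma integral_pieces (k : R -> R) (t : nat -> R) (m : nat) (k' : nat -> R -> R) :
  (forall i, (i < m)%N -> [/\ continuous (k' i), t i < t i.+1 & {in `]t i, t i.+1[, k =1 k' i}]) ->
  mu.-integrable `[t 0%N, t m] (EFin \o k) /\
  \int[mu]_(x in `[t 0%N, t m]) k x =
  \sum_(i < m) \int[mu]_(x in `[t i, t i.+1]) k' i x.
Proof.
elim: m => [|m IH] H.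
  rewrite big_ord0 set_itv1 Rintegral_set1; split => //.
  have : mu.-integrable `[t 0%N, t 0%N] (EFin \o (fun=> k (t 0%N))).
    by apply: continuous_integrable => x; exact: cvg_cst.
  by rewrite set_itv1; apply: eq_integrable => // x /set_mem ->.
have [|int IHE] := IH; first by move=> i im; apply: H; exact: ltnW.
have [ck' tt kk'] := H m (ltnSn m).
have [int' E'] := integral_piece ck' tt kk'.
have t0m : t 0%N <= t m.
  have : forall n, (n <= m)%N -> t 0%N <= t n.
    elim=> // n IHn nm; rewrite (le_trans (IHn (ltnW nm))) //.
    by have [_ /ltW] := H n (ltnW nm).
  exact.
have int1 : mu.-integrable `[t 0%N, t m.+1] (EFin \o k).
  have -> : `[t 0%N, t m.+1]%classic = `[t 0%N, t m]%classic `|` `]t m, t m.+1]%classic.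
    by rewrite -itv_bndbnd_setU // bnd_simp // ltW.
  apply: integrable_disjoint_union => //.
    apply/disj_set2P; rewrite -subset0 => x [] /=; rewrite !in_itv /=.
    by move=> /andP[_ xp] /andP[+ _]; rewrite ltNge xp.
  apply: integrableS int' => //.
  by apply: subset_itvr; rewrite bnd_simp.
split => //; rewrite big_ord_recr /= -IHE -E'.
have := @Rintegral_itvB R k (BLeft (t 0%N)) (BRight (t m.+1)) (t m) int1.
rewrite !bnd_simp => /(_ t0m (ltW tt)) /eqP; rewrite subr_eq => /eqP ->.
rewrite addrC Rintegral_itv_obnd_cbnd //.
apply: integrableS int' => //.
by apply: subset_itvr; rewrite bnd_simp.
Qed.

Lemma integral_ord_pieces (k : R -> R) (t : nat -> R) (m : nat) (k' : 'I_m -> R -> R) :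
  (forall i : 'I_m, [/\ continuous (k' i), t i < t i.+1 & {in `]t i, t i.+1[, k =1 k' i}]) ->
  \int[mu]_(x in `[t 0%N, t m]) k x =
  \sum_(i < m) \int[mu]_(x in `[t i, t i.+1]) k' i x.
Proof.
move=> H; pose k2 (i : nat) := if insub i is Some i' then k' i' else fun=> 0.
have k2E (i : 'I_m) : k2 i = k' i by rewrite /k2 valK.
have [|_ ->] := @integral_pieces k t m k2.
  by move=> i im; have := H (Ordinal im); rewrite -k2E.
by apply: eq_bigr => i _; rewrite k2E.
Qed.

End Pieces.

Section Partition.
Variables (R : realType) (m : nat) (t : nat -> R).
Hypothesis tS : forall i, (i < m)%N -> t i < t i.+1.

Lemma partition_le i j : (i <= j)%N -> (j <= m)%N -> t i <= t j.
Proof.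
elim: j => [|j IH]; first by rewrite leqn0 => /eqP ->.
rewrite leq_eqVlt ltnS => /orP[/eqP -> //|ij] jm.
by rewrite (le_trans (IH ij (ltnW jm))) // ltW // tS.
Qed.

Lemma partition_cover s : t 0%N <= s <= t m -> (0 < m)%N ->
  exists2 i, (i < m)%N & t i <= s <= t i.+1.
Proof.
move=> /andP[s0 sm] m0.
have : forall n, (n <= m)%N -> (0 < n)%N -> s <= t n -> exists2 i, (i < n)%N & t i <= s <= t i.+1.
  elim=> // -[|n] IH nm _ sn; first by exists 0%N => //; rewrite s0.
  have [sn'|sn'] := leP s (t n.+1); last by exists n.+1 => //; rewrite sn ltW.
  have [i ii si] := IH (ltnW nm) isT sn'.
  by exists i => //; exact: ltnW.
by move/(_ m (leqnn m) m0 sm).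
Qed.

Lemma partition_uniq s i j : (i < m)%N -> (j < m)%N ->
  t i < s < t i.+1 -> t j <= s <= t j.+1 -> i = j.
Proof.
move=> im jm /andP[is' si] /andP[js sj].
have [ij|ji|//] := ltngtP i j.
- by have := le_trans (partition_le ij (ltnW jm)) js; rewrite leNgt si.
- by have := le_trans sj (partition_le ji (ltnW im)); rewrite leNgt is'.
Qed.

End Partition.

Section Arcs.
Variable R : realType.
Local Notation mu := (@lebesgue_measure R).

(** There is one arc for each smooth piece of each curve, parametrized by the C1 functions on the
    whole line that agree with the curve on that closed piece. *)
Lemma pw_smooth_arcs (Om : set (R * R)) (c : nat) (g : 'I_c -> R -> R * R) :
  pw_smooth_boundary Om g ->
  exists (A : finType) (X Y : A -> R -> R) (l r : A -> R),
    arc_boundary 1 Om X Y l r /\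
    forall f : R * R -> R, continuous f ->
      bint_x g f = \sum_a \int[mu]_(s in `[l a, r a]) (f (X a s, Y a s) * derive1 (Y a) s) /\
      bint_y g f = - \sum_a \int[mu]_(s in `[l a, r a]) (f (X a s, Y a s) * derive1 (X a) s).
Proof.
move=> [_ /choice[m /choice[t H]] cover].
have t0 j : t j 0%N = 0 by have [] := H j.
have t1 j : t j (m j) = 1 by have [] := H j.
have tS j i : (i < m j)%N -> t j i < t j i.+1 by have [_ _ + _] := H j; exact.
have m0 j : (0 < m j)%N.
  rewrite lt0n; apply/eqP => mj0; have := t1 j; rewrite mj0 t0.
  by move/eqP; rewrite eq_sym oner_eq0.
pose A : finType := {j : 'I_c & 'I_(m j)}.
have /choice[h Hh] (a : A) : exists h : (R -> R) * (R -> R),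
  [/\ forall s, t (tag a) (tagged a) <= s <= t (tag a) (tagged a).+1 ->
        g (tag a) s = (h.1 s, h.2 s),
      C1 h.1 /\ C1 h.2,
      forall s, t (tag a) (tagged a) < s < t (tag a) (tagged a).+1 ->
        outward_at Om (g (tag a) s) (derive1 h.1 s, derive1 h.2 s) &
      forall s, t (tag a) (tagged a) < s < t (tag a) (tagged a).+1 ->
        forall j' s', 0 <= s' <= 1 -> g j' s' = g (tag a) s -> j' = tag a /\ s' = s].
  have [_ _ _ /(_ _ (ltn_ord (tagged a)))[h1 [h2 [gE [dh [ch1 ch2]] _ out simple]]]] := H (tag a).
  exists (h1, h2); split; [exact: gE| |exact: out|exact: simple].
  by split; split; [move=> x; exact: (dh x).1|exact: ch1|move=> x; exact: (dh x).2|exact: ch2].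
pose X a := (h a).1; pose Y a := (h a).2.
pose l (a : A) := t (tag a) (tagged a); pose r (a : A) := t (tag a) (tagged a).+1.
have gE a s : l a <= s <= r a -> g (tag a) s = (X a s, Y a s) by have [+ _ _ _] := Hh a; exact.
have lr a : l a < r a by apply: tS; exact: ltn_ord.
have lr01 a s : l a <= s <= r a -> 0 <= s <= 1.
  move=> /andP[ls sr]; rewrite -(t0 (tag a)) -(t1 (tag a)); apply/andP; split.
    by apply: le_trans ls; apply: (partition_le (tS (tag a))) => //; exact: ltnW.
  by apply: (le_trans sr); apply: (partition_le (tS (tag a))) => //; exact: ltn_ord.
have CX a : C1 (X a) by have [_ [Ch _] _ _] := Hh a; exact: Ch.
have CY a : C1 (Y a) by have [_ [_ Ch] _ _] := Hh a; exact: Ch.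
exists A, X, Y, l, r; split.
  split=> //.
  - by rewrite expr1n.
  - rewrite cover; apply/seteqP; split=> z /=.
      move=> [j [s [s01 ->]]].
      have [|i im si] := partition_cover (t := t j) (m := m j) (s := s) _ (m0 j).
        by rewrite t0 t1.
      pose a : A := Tagged _ (Ordinal im).
      by exists a, s; split => //; rewrite -gE.
    move=> [a [s [slr ->]]]; exists (tag a), s; split; first exact: lr01 slr.
    by rewrite gE.
  - move=> a s slr; rewrite !mul1r -gE.
      by have [_ _ out _] := Hh a; exact: out.
    by have /andP[/ltW -> /ltW ->] := slr.
  - move=> a s slr b s' slr' E.
    have slr2 : l a <= s <= r a by have /andP[/ltW -> /ltW ->] := slr.
    have [_ _ _ simple] := Hh a.
    have [||tE sE] := simple s slr (tag b) s'; first exact: lr01 slr'.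
      by rewrite !gE.
    (* Simplicity gives the same curve and the same parameter; the piece is the same because [s] is
       interior to its own. *)
    split => //; move: a b tE slr slr' {slr2 simple E}.
    move=> [j i] [j' i'] /= E; subst j'; rewrite sE /l /r /= => slr slr'.
    congr (Tagged _ _); apply/val_inj => /=; apply/esym.
    exact: (partition_uniq (tS j) (ltn_ord i) (ltn_ord i') slr slr').
move=> f cf.
(* Inside a piece the curve agrees near [s] with its C1 parametrization, hence so do the
   derivatives; [p] and [q] stand for either coordinate. *)
have dg (p : R * R -> R) (q : (R -> R) * (R -> R) -> R -> R) (a : A) s :
    (forall h1 h2 u, p (h1 u, h2 u) = q (h1, h2) u) -> l a < s < r a ->
    derive1 (fun u => p (g (tag a) u)) s = derive1 (q (h a)) s.
  move=> pq /andP[ls sr]; rewrite !derive1E; apply: near_eq_derive.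
  have nl : \forall u \near s, l a < u by exact: lt_nbhsr.
  have nr : \forall u \near s, u < r a by exact: lt_nbhsl.
  near=> u; rewrite gE; first by rewrite pq -surjective_pairing.
  by apply/andP; split; apply: ltW; near: u.
have cX a : continuous (X a) := C1_continuous (CX a).
have cY a : continuous (Y a) := C1_continuous (CY a).
have cdX a : continuous (derive1 (X a)) := (CX a).2.
have cdY a : continuous (derive1 (Y a)) := (CY a).2.
have cfXY a : continuous (fun s => f (X a s, Y a s)).
  move=> s; apply: (continuous_comp (f := fun s => (X a s, Y a s))); last exact: cf.
  exact: (cvg_pair (cX a s) (cY a s)).
pose mkA j (i : 'I_(m j)) : A := Tagged (fun j => 'I_(m j)) i.
have sumE (G : A -> R) : \sum_(j < c) \sum_(i < m j) G (mkA j i) = \sum_a G a.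
  rewrite (@sig_big_dep _ _ _ _ (fun j => 'I_(m j)) xpredT (fun _ => xpredT) (fun j i => G (mkA j i))) /=.
  by apply: eq_bigr => -[].
split.
  transitivity (\sum_(j < c) \sum_(i < m j) \int[mu]_(s in `[t j i, t j i.+1])
      (f (X (mkA j i) s, Y (mkA j i) s) * derive1 (Y (mkA j i)) s)).
    apply: eq_bigr => j _; rewrite -[X in `[X, _]](t0 j) -[X in `[_, X]](t1 j).
    apply: integral_ord_pieces => i; split.
    - by move=> s; apply: cvgM; [exact: cfXY|exact: cdY].
    - exact: tS.
    - move=> s; rewrite in_itv /= => sI.
      rewrite (dg snd (fun h => h.2) (mkA j i)) //.
      by rewrite (gE (mkA j i)) // /l /r /=; have /andP[/ltW -> /ltW ->] := sI.
  exact: (sumE (fun a => \int[mu]_(s in `[l a, r a]) (f (X a s, Y a s) * derive1 (Y a) s))).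
transitivity (\sum_(j < c) \sum_(i < m j) - \int[mu]_(s in `[t j i, t j i.+1])
    (f (X (mkA j i) s, Y (mkA j i) s) * derive1 (X (mkA j i)) s)).
  apply: eq_bigr => j _; rewrite -[X in `[X, _]](t0 j) -[X in `[_, X]](t1 j).
  rewrite (@integral_ord_pieces R _ (t j) (m j) (fun i s =>
    -1 * (f (X (mkA j i) s, Y (mkA j i) s) * derive1 (X (mkA j i)) s))).
    apply: eq_bigr => i _; rewrite RintegralZl ?mulN1r //.
    by apply: continuous_integrable => s; apply: cvgM; [exact: cfXY|exact: cdX].
  move=> i; split.
  - move=> s; apply: cvgM; first exact: cvg_cst.
    by apply: cvgM; [exact: cfXY|exact: cdX].
  - exact: tS.
  - move=> s; rewrite in_itv /= => sI.
    rewrite (dg fst (fun h => h.1) (mkA j i)) // mulN1r.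
    by rewrite (gE (mkA j i)) // /l /r /=; have /andP[/ltW -> /ltW ->] := sI.
rewrite -sumrN.
exact: (sumE (fun a => - \int[mu]_(s in `[l a, r a]) (f (X a s, Y a s) * derive1 (X a) s))).
Unshelve. all: by end_near. Qed.
End Arcs.

(** * Green's formula for monomials *)

Section Monomials.
Variable R : realType.
Local Notation mu := (@lebesgue_measure R).

Lemma C1M (f g : R -> R) : C1 f -> C1 g -> C1 (fun s => f s * g s).
Proof.
move=> Cf Cg; split=> [x|].
  by have := derivableM (Cf.1 x) (Cg.1 x).
have -> : derive1 (fun s => f s * g s) = fun s => f s * derive1 g s + g s * derive1 f s.
  by apply/funext => s; rewrite !derive1E (deriveM (Cf.1 s) (Cg.1 s)).
move=> s; apply: cvgD; apply: cvgM.
- exact: C1_continuous.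
- exact: Cg.2.
- exact: C1_continuous.
- exact: Cf.2.
Qed.

Lemma C1_exp (f : R -> R) n : C1 f -> C1 (fun s => f s ^+ n).
Proof.
move=> Cf; elim: n => [|n IH].
  by rewrite (_ : (fun _ => _) = fun=> 1); [exact: C1_cst|apply/funext => s; rewrite expr0].
rewrite (_ : (fun _ => _) = fun s => f s * f s ^+ n); first exact: C1M.
by apply/funext => s; rewrite exprS.
Qed.

Lemma derive1_monomial (a : nat) (c x : R) :
  derive1 (fun s : R => s ^+ a * c) x = a%:R * x ^+ a.-1 * c.
Proof.
rewrite (derive1Mr c (f := fun s : R => s ^+ a)); first by rewrite exp_derive1.
exact: (C1_exp a (@C1_id R)).1.
Qed.

Lemma closure_swap (Om : set (R * R)) (z : R * R) :
  closure [set w | Om (w.2, w.1)] z -> closure Om (z.2, z.1).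
Proof.
move=> cz B nB.
have sw : (w.2, w.1) @[w --> z] --> (z.2, z.1) by exact: (cvg_pair cvg_snd cvg_fst).
by have [w [Ow Bw]] := cz _ (sw _ nB); exists (w.2, w.1).
Qed.

(** Exchanging the coordinates is a reflection and reverses orientation. This reduces the formula
    for the y-derivative to the one for the x-derivative. *)
Lemma arc_boundary_swap (sg : R) (Om : set (R * R)) (A : finType) (X Y : A -> R -> R) (l r : A -> R) :
  arc_boundary sg Om X Y l r ->
  arc_boundary (- sg) [set w | Om (w.2, w.1)] Y X l r.
Proof.
move=> arcs; split.
- by rewrite sqrrN (arc_sg arcs).
- exact: arc_lr arcs.
- exact: arc_C1Y arcs.
- exact: arc_C1X arcs.
- have cl := arc_cover arcs; apply/seteqP; split=> -[y x] /=.
    move=> [/closure_swap /= cz nO].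
    have : (closure Om `\` Om) (x, y) by [].
    by rewrite cl => -[a [s [slr [-> ->]]]]; exists a, s.
  move=> [a [s [slr [-> ->]]]].
  have : (closure Om `\` Om) (X a s, Y a s) by rewrite cl; exists a, s.
  move=> [cO nO]; split => //.
  suff : closure [set w : R * R | Om (w.1, w.2)] (X a s, Y a s).
    exact: (@closure_swap [set w : R * R | Om (w.2, w.1)]).
  by rewrite (_ : [set w | _] = Om) //; apply/funext => -[].
- move=> a s slr; have [e [e0 out]] := arc_outward arcs slr.
  exists e; split => // h he; have [w1 w2] := out h he.
  rewrite !mulNr !mulrN !opprK; split; [exact: w1|exact: w2].
- move=> a s slr b s' slr' [yE xE].
  by apply: (arc_simple arcs slr slr'); rewrite xE yE.
Qed.

(** The parameter intervals are bounded as well, since [arc_integral] applies Fubini in the height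
    and the parameter. *)
Lemma arcs_bound (Om : set (R * R)) (A : finType) (X Y : A -> R -> R) (l r : A -> R) :
  bounded2 Om -> (forall a, continuous (X a)) -> (forall a, continuous (Y a)) ->
  exists2 M, 0 < M &
    (forall z, Om z -> `|z.1| < M /\ `|z.2| < M) /\
    forall a, [/\ `|l a| < M, `|r a| < M, forall s, l a <= s <= r a -> `|X a s| < M &
      forall s, l a <= s <= r a -> `|Y a s| < M].
Proof.
move=> [B HB] cX cY.
have /choice[K HK] (a : A) : exists K, 0 < K /\ [/\ `|l a| < K, `|r a| < K,
    forall s, l a <= s <= r a -> `|X a s| < K & forall s, l a <= s <= r a -> `|Y a s| < K].
  have [K1 K10 HK1] := continuous_segment_bound (l a) (r a) (cX a).
  have [K2 K20 HK2] := continuous_segment_bound (l a) (r a) (cY a).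
  have nl := normr_ge0 (l a); have nr := normr_ge0 (r a).
  exists (K1 + K2 + `|l a| + `|r a|); split; first by lra.
  split; [lra|lra|move=> s /HK1|move=> s /HK2]; lra.
have K0 a : 0 <= K a by exact: ltW (HK a).1.
have KS a : K a <= \sum_b K b by rewrite (bigD1 a) //= lerDl sumr_ge0.
have S0 : 0 <= \sum_b K b by exact: sumr_ge0.
have nB := normr_ge0 B; have lB := ler_norm B.
exists (`|B| + 1 + \sum_b K b); first by lra.
split=> [z /HB[z1 z2]|a]; first by split; lra.
have [_ [h1 h2 h3 h4]] := HK a; have Ka := KS a.
by split; [lra|lra|move=> s /h3; lra|move=> s /h4; lra].
Qed.

Definition monomial (a b : nat) (z : R * R) : R := z.1 ^+ a * z.2 ^+ b.

Lemma monomial_continuous a b : continuous (monomial a b).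
Proof.
move=> z; apply: cvgM.
- apply: (continuous_comp (f := fst) (g := fun x : R => x ^+ a)); first exact: cvg_fst.
  exact: exprn_continuous.
- apply: (continuous_comp (f := snd) (g := fun x : R => x ^+ b)); first exact: cvg_snd.
  exact: exprn_continuous.
Qed.

Lemma green_monomial (sg : R) (Om : set (R * R)) (A : finType) (X Y : A -> R -> R)
    (l r : A -> R) (M : R) (a b : nat) : open Om -> arc_boundary sg Om X Y l r -> 0 < M ->
  (forall z, Om z -> `|z.1| < M /\ `|z.2| < M) ->
  (forall a, [/\ `|l a| < M, `|r a| < M, forall s, l a <= s <= r a -> `|X a s| < M &
      forall s, l a <= s <= r a -> `|Y a s| < M]) ->
  \int[mu]_y \int[mu]_x (\1_Om (x, y) * (a%:R * monomial a.-1 b (x, y))) =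
  sg * \sum_e \int[mu]_(s in `[l e, r e]) (monomial a b (X e s, Y e s) * derive1 (Y e) s).
Proof.
move=> oOm arcs M0 OmM HM.
have dF y x : derive1 (fun t => monomial a b (t, y)) x = a%:R * monomial a.-1 b (x, y).
  by rewrite /monomial /= mulrA; exact: derive1_monomial.
have FC1 f g : C1 f -> C1 g -> C1 (fun s => monomial a b (f s, g s)).
  by move=> Cf Cg; apply: C1M; exact: C1_exp.
have Fx_continuous : continuous (fun z : R * R => derive1 (fun x => monomial a b (x, z.2)) z.1).
  rewrite (_ : (fun _ => _) = fun z => a%:R * monomial a.-1 b z).
    by move=> z; apply: cvgM; [exact: cvg_cst|exact: monomial_continuous].
  by apply/funext => -[x y] /=; rewrite dF.
have lM e : `|l e| < M by have [] := HM e.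
have rM e : `|r e| < M by have [] := HM e.
have XM e : forall s, l e <= s <= r e -> `|X e s| < M by have [] := HM e.
have YM e : forall s, l e <= s <= r e -> `|Y e s| < M by have [] := HM e.
rewrite -(green_arcs (F := fun x y => monomial a b (x, y)) oOm arcs FC1 Fx_continuous OmM lM rM XM YM M0).
by do 2 (apply: eq_Rintegral => ? _); rewrite dF.
Qed.

End Monomials.

Section GreenPlane.
Variables (R : realType) (Om : set (R * R)) (c : nat) (g : 'I_c -> R -> R * R).
Hypotheses (oOm : open Om) (bOm : bounded2 Om) (sOm : pw_smooth_boundary Om g).

(** The second formula is the first one for the reflected domain, whose sign -1 is the minus sign in
    [bint_y]. At exponent 0 the factor 0 neutralizes the truncated predecessor. *)
Lemma green_plane a b :
  bint_x g (@monomial R a b) = \int[@area R]_(z in Om) (a%:R * monomial a.-1 b z) /\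
  bint_y g (@monomial R a b) = \int[@area R]_(z in Om) (b%:R * monomial a b.-1 z).
Proof.
have [A [X [Y [l [r [arcs bE]]]]]] := pw_smooth_arcs sOm.
have [M M0 [OmM HM]] := arcs_bound l r bOm
  (fun e => C1_continuous (arc_C1X arcs e)) (fun e => C1_continuous (arc_C1Y arcs e)).
have [-> ->] := bE _ (@monomial_continuous R a b).
have bx n p q : boxed M (fun z => \1_Om z * (n%:R * monomial p q z)).
  apply: indic_mul_boxed => // z.
  by apply: cvgM; [exact: cvg_cst|exact: monomial_continuous].
split.
  rewrite Rintegral_indic -(boxed_Rintegral2 (bx _ _ _)).
  by rewrite (green_monomial a b oOm arcs M0 OmM HM) mul1r.
rewrite Rintegral_indic -(boxed_Rintegral1 (bx _ _ _)).
have arcs' := arc_boundary_swap arcs.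
have oOm' : open [set w | Om (w.2, w.1)].
  have cs : continuous (fun w : R * R => (w.2, w.1)).
    by move=> w; exact: (cvg_pair cvg_snd cvg_fst).
  by move/continuousP: cs; apply.
have OmM' z : [set w | Om (w.2, w.1)] z -> `|z.1| < M /\ `|z.2| < M.
  by move=> /= /OmM[].
have HM' e : [/\ `|l e| < M, `|r e| < M, forall s, l e <= s <= r e -> `|Y e s| < M &
    forall s, l e <= s <= r e -> `|X e s| < M] by have [] := HM e.
have monC p q x y : monomial p q (y, x) = monomial q p (x, y) :> R.
  by rewrite /monomial mulrC.
have := green_monomial b a oOm' arcs' M0 OmM' HM'.
rewrite mulN1r; under [in RHS]eq_bigr do under eq_Rintegral do rewrite monC.
move=> <-; do 2 (apply: eq_Rintegral => ? _); rewrite monC; congr (_ * _).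
Qed.
End GreenPlane.

(** * Summation-by-parts matrices and cubature *)

Section MonomialIndex.
Local Open Scope nat_scope.

Lemma etapS p : etap p.+1 = etap p + p.+2.
Proof. by rewrite /etap -divn2 -[in RHS]divn2; nia. Qed.

Lemma etapE j : etap j = (j * j.+1)./2 + j.+1.
Proof. by rewrite /etap -divn2 -[in RHS]divn2; nia. Qed.

Lemma etap_homo i j : i <= j -> etap i <= etap j.
Proof.
elim: j => [|j IH]; first by rewrite leqn0 => /eqP ->.
rewrite leq_eqVlt ltnS => /orP[/eqP -> //|/IH ij].
by rewrite etapS (leq_trans ij) // leq_addr.
Qed.

Lemma ltn_etap j : j < etap j.
Proof. by rewrite etapE addnS ltnS leq_addl. Qed.

(** The [j] with [etap j <= k] form the initial segment of length [d], by monotonicity of [etap];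
    the scanned range is long enough because [j < etap j]. *)
Lemma mon_degE d k : k < etap d -> (forall j, j < d -> etap j <= k) -> mon_deg k = d.
Proof.
move=> kd dk.
have dk1 : d <= k.+1.
  by case: d kd dk => // d _ /(_ d (ltnSn d)) H; rewrite ltnS (leq_trans _ H) // ltnW // ltn_etap.
rewrite /mon_deg -(subnKC dk1) iotaD count_cat add0n.
rewrite (eq_in_count (a2 := predT)); last first.
  by move=> j; rewrite mem_iota /= add0n => /dk ->.
rewrite count_predT size_iota (eq_in_count (a2 := pred0)) ?count_pred0 ?addn0 //.
move=> j; rewrite mem_iota => /andP[dj _] /=; apply/negbTE; rewrite -ltnNge.
exact: leq_trans kd (etap_homo dj).
Qed.

Lemma mon_exp_surj p a b : a + b <= p ->
  exists2 k, k < etap p & mon_exp k = (a, b).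
Proof.
set d := a + b => dp.
exists ((d * d.+1)./2 + a).
  apply: leq_trans (etap_homo dp); rewrite etapE ltn_add2l /d.
  by rewrite ltnS leq_addr.
rewrite /mon_exp (@mon_degE d); first by rewrite addKn /d addKn.
  by rewrite etapE ltn_add2l ltnS leq_addr.
move=> j jd; rewrite (leq_trans _ (leq_addr _ _)) //.
move: jd; case: (d) => // d'; rewrite ltnS => /etap_homo H.
by rewrite (leq_trans H).
Qed.

Lemma mon_exp_le p k : k < etap p -> (mon_exp k).1 + (mon_exp k).2 <= p.
Proof.
move=> kp.
have ex : exists d, k < etap d by exists p.
case: (ex_minnP ex) => d kd dmin.
have dk : forall j, j < d -> etap j <= k.
  by move=> j jd; rewrite leqNgt; apply/negP => /dmin; rewrite leqNgt jd.
rewrite /mon_exp (mon_degE kd dk) /= subnKC ?dmin //.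
by rewrite leq_subLR; move: kd; rewrite etapE addnS ltnS.
Qed.

(** Greedy choice: the first factor takes as many powers of x as degree [p] allows and is then
    filled up with powers of y. Thus products of two basis monomials give every monomial of degree
    at most [2p]. *)
Lemma mon_exp_split p a b : a + b <= p + p -> exists k m,
  [/\ k < etap p, m < etap p, (mon_exp k).1 + (mon_exp m).1 = a
    & (mon_exp k).2 + (mon_exp m).2 = b].
Proof.
move=> abp; pose a1 := minn a p; pose b1 := minn b (p - a1).
have [|k kp kE] := @mon_exp_surj p a1 b1; first by rewrite /a1 /b1; lia.
have [|m mp mE] := @mon_exp_surj p (a - a1) (b - b1); first by rewrite /a1 /b1; lia.
by exists k, m; rewrite kE mE /= /a1 /b1; split => //; lia.
Qed.
End MonomialIndex.

(** * Construction of the matrices of an operator *)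

Section LinearAlgebra.
Variable R : realType.

Lemma full_col_rank_left_inverse n N (V : 'M[R]_(n, N)) : \rank V = N ->
  exists L : 'M[R]_(N, n), L *m V = 1%:M.
Proof.
move=> rV; have : row_full V by rewrite /row_full rV.
by move/row_fullP.
Qed.

(* With a left inverse [L] of [V], the matrix [L^T B L] has the prescribed
   restriction to the columns of [V], and an antisymmetric matrix with
   [QA V = X] exists as soon as [V^T X] is antisymmetric. *)
Lemma sbp_matrices n N (V Vx : 'M[R]_(n, N)) (H : 'M[R]_n) (B : 'M[R]_N) :
  \rank V = N -> H^T = H -> B^T = B -> V^T *m H *m Vx + Vx^T *m H *m V = B ->
  exists QA E : 'M[R]_n, [/\ QA^T = - QA, E^T = E, V^T *m E *m V = B &
    (QA + 2^-1 *: E) *m V = H *m Vx].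
Proof.
move=> /full_col_rank_left_inverse[L LV] HT BT HB.
have VL : V^T *m L^T = 1%:M by rewrite -trmx_mul LV trmx1.
have [E ET VEV] : exists2 E : 'M[R]_n, E^T = E & V^T *m E *m V = B.
  exists (L^T *m B *m L); first by rewrite !trmx_mul trmxK BT mulmxA.
  by rewrite !mulmxA VL mul1mx -mulmxA LV mulmx1.
pose X := H *m Vx - 2^-1 *: (E *m V).
pose W := V^T *m X.
(* By the hypothesis on [B], [W] is half the difference of [V^T *m H *m Vx] and its transpose. *)
have WT : X^T *m V = - W.
  apply/eqP; rewrite -subr_eq0 opprK /W /X linearB linearZ /= !trmx_mul ET HT.
  rewrite mulmxBl mulmxBr -scalemxAl -scalemxAr !mulmxA VEV.
  have -> : Vx^T *m H *m V = B - V^T *m H *m Vx by rewrite -HB addrC addKr.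
  move: (V^T *m H *m Vx) => P; apply/eqP/matrixP => i j; rewrite !mxE; lra.
have WT' : W^T = - W by rewrite -WT /W trmx_mul trmxK.
have XE : X = H *m Vx - 2^-1 *: (E *m V) by [].
clearbody W X.
(* The first two terms are antisymmetric together, but applied to [V] they give [X + L^T *m W]; the
   third term, antisymmetric like [W], removes the excess. *)
pose QA := X *m L - L^T *m X^T - L^T *m W *m L.
exists QA, E; split => //.
- rewrite /QA !raddfB /= !trmx_mul !trmxK WT' mulNmx mulmxN !opprK mulmxA.
  by congr (_ + _); rewrite addrC.
- have -> : (QA + 2^-1 *: E) *m V = QA *m V + 2^-1 *: (E *m V).
    by rewrite mulmxDl scalemxAl.
  have -> : QA *m V = X.
    rewrite /QA !mulmxBl -!mulmxA LV !mulmx1 WT mulmxN opprK.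
    by rewrite addrK.
  by rewrite XE subrK.
Qed.

End LinearAlgebra.

Section SBP.
Variables (R : realType) (n : nat) (S : 'I_n -> R * R).
Variables (dmono : nat -> R * R -> R) (bint : (R * R -> R) -> R) (p : nat).

(** The common ground of the two sides of the equivalence: by Green's formula it is exactness of the
    weights on the derivatives of products of two basis monomials. *)
Definition sbp_weights (w : 'I_n -> R) := forall k m, (k < etap p)%N -> (m < etap p)%N ->
  \sum_i w i * (dmono k (S i) * mono m (S i) + mono k (S i) * dmono m (S i)) =
  bint (fun z => mono k z * mono m z).

Lemma diag_formE N N' (d : 'rV[R]_n) (U : 'M[R]_(n, N)) (W : 'M[R]_(n, N')) k m :
  (U^T *m diag_mx d *m W) k m = \sum_i d 0 i * (U i k * W i m).
Proof.
rewrite mxE; apply: eq_bigr => i _; rewrite mul_mx_diag !mxE.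
by rewrite mulrA [d 0 i * _]mulrC.
Qed.

(** With [H] the diagonal matrix of the weights, [sbp_weights] is the compatibility condition of
    [sbp_matrices], and [tau = p] is taken. *)
Lemma sbp_op_of_weights (w : 'I_n -> R) : (forall i, 0 < w i) ->
  \rank (vandermonde S p) = etap p -> sbp_weights w ->
  exists D, SBP_op S dmono bint p true D.
Proof.
move=> w0 rV Hw.
pose d : 'rV[R]_n := \row_i w i.
pose H := diag_mx d.
pose V := vandermonde S p.
pose Vx : 'M[R]_(n, etap p) := \matrix_(i, k) dmono k (S i).
pose B : 'M[R]_(etap p) := \matrix_(k, m) bint (fun z => mono k z * mono m z).
have HT : H^T = H by rewrite tr_diag_mx.
have Hu : H \in unitmx.
  rewrite unitmxE det_diag unitfE; apply/prodf_neq0 => i _.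
  by rewrite mxE gt_eqF.
have BT : B^T = B.
  apply/matrixP => k m; rewrite !mxE; congr bint.
  by apply/funext => z; rewrite mulrC.
have HB : V^T *m H *m Vx + Vx^T *m H *m V = B.
  apply/matrixP => k m; rewrite mxE !diag_formE -big_split /= !mxE -Hw //.
  by apply: eq_bigr => i _; rewrite !mxE; ring.
have [QA [E [QAT ET VEV QV]]] := sbp_matrices rV HT BT HB.
exists (invmx H *m (QA + 2^-1 *: E)), H, QA, E, p.
have nodeV k (kp : (k < etap p)%N) : nodevec S (mono k) = V *m delta_mx (Ordinal kp) 0.
  by rewrite -colE; apply/colP => i; rewrite !mxE.
have nodeVx k (kp : (k < etap p)%N) : nodevec S (dmono k) = Vx *m delta_mx (Ordinal kp) 0.
  by rewrite -colE; apply/colP => i; rewrite !mxE.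
split => //.
- split => // k kp.
  by rewrite nodeV nodeVx mulmxA -(mulmxA (invmx H)) QV mulKmx.
- split => // v v0.
  rewrite diag_formE.
  have [i vi] : exists i, v i 0 != 0.
    apply/existsP; apply: contraNT v0 => /existsPn vi.
    by apply/eqP/colP => i; rewrite mxE; apply/eqP; rewrite -[_ == _]negbK vi.
  have ge0 j : 0 <= d 0 j * (v j 0 * v j 0).
    by apply: mulr_ge0; [rewrite mxE; exact: ltW|rewrite -expr2 sqr_ge0].
  rewrite (bigD1 i) //= ltr_pwDl ?sumr_ge0 //.
  by rewrite mxE mulr_gt0 // -expr2 exprn_even_gt0.
- move=> k m kp mp; rewrite (nodeV _ kp) (nodeV _ mp) trmx_mul trmx_delta.
  rewrite -!mulmxA (mulmxA E) (mulmxA V^T) (mulmxA V^T) VEV mulmxA.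
  by rewrite -rowE -colE !mxE.
- by rewrite /= diag_mx_is_diag.
Qed.

(** The weights are the diagonal of [H], positive by testing on unit vectors. The relation
    [E = H *m D + (H *m D)^T], evaluated on node vectors where [D] is exact, gives [sbp_weights]. *)
Lemma weights_of_sbp_op (D : 'M[R]_n) : SBP_op S dmono bint p true D ->
  exists w : 'I_n -> R, (forall i, 0 < w i) /\ sbp_weights w.
Proof.
move=> [H [QA [E [tau [[ptau DV] [HT Hpos] [DE [QAT ET]] EB /= Hdiag]]]]].
pose d : 'rV[R]_n := \row_i H i i.
have HE : H = diag_mx d.
  apply/matrixP => i j; rewrite !mxE; have [->|ij] := eqVneq i j; first by rewrite mulr1n.
  by rewrite (is_diag_mxP Hdiag).
have w0 i : 0 < H i i.
  have := Hpos (delta_mx i 0); rewrite HE diag_formE (bigD1 i) //= big1.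
    rewrite !mxE !eqxx !mulr1 addr0 mulr1n; apply.
    by apply/eqP => /colP/(_ i)/eqP; rewrite !mxE !eqxx oner_eq0.
  by move=> j ji; rewrite !mxE (negbTE ji) mul0r mulr0.
exists (fun i => H i i); split => // k m kp mp.
have Hu : H \in unitmx.
  rewrite HE unitmxE det_diag unitfE; apply/prodf_neq0 => i _.
  by rewrite mxE gt_eqF.
have HD : H *m D = QA + 2^-1 *: E by rewrite DE mulKVmx.
have tp : (etap p <= etap tau)%N by exact: etap_homo.
rewrite -(EB k m) ?(leq_trans _ tp) //.
pose u := nodevec S (mono k); pose v := nodevec S (mono m).
have sumQ : E = H *m D + (H *m D)^T.
  rewrite HD linearD linearZ /= QAT ET addrACA subrr add0r -scalerDl.
  by rewrite (_ : _ + _ = 1 :> R) ?scale1r //; lra.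
rewrite [in RHS]sumQ mulmxDr mulmxDl trmx_mul HT.
have -> : u^T *m (H *m D) *m v = u^T *m H *m nodevec S (dmono m).
  by rewrite -!mulmxA DV.
have -> : u^T *m (D^T *m H) *m v = (nodevec S (dmono k))^T *m H *m v.
  by rewrite -(DV _ kp) trmx_mul !mulmxA.
rewrite mxE HE !diag_formE -big_split /=; apply: eq_bigr => i _.
by rewrite !mxE eqxx mulr1n; ring.
Qed.

End SBP.

Section MonoProduct.
Variable R : realType.

Lemma monoM k m : (fun z : R * R => mono k z * mono m z) =
  monomial ((mon_exp k).1 + (mon_exp m).1) ((mon_exp k).2 + (mon_exp m).2).
Proof. by apply/funext => z; rewrite /mono /monomial !exprD; ring. Qed.

(** The product rule for powers; zero exponents are treated apart because of the truncated
    predecessor. *)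
Lemma dpow_prod a b (x : R) : a%:R * x ^+ a.-1 * x ^+ b + x ^+ a * (b%:R * x ^+ b.-1) =
  (a + b)%:R * x ^+ (a + b).-1.
Proof.
case: a b => [|a] [|b] /=; rewrite ?addn0 ?add0n ?expr0 ?natrD ?addnS /= ?exprS ?exprD; ring.
Qed.

Lemma mono_dxM k m (z : R * R) : mono_dx k z * mono m z + mono k z * mono_dx m z =
  ((mon_exp k).1 + (mon_exp m).1)%:R *
  monomial ((mon_exp k).1 + (mon_exp m).1).-1 ((mon_exp k).2 + (mon_exp m).2) z.
Proof. by rewrite /monomial [RHS]mulrA -dpow_prod /mono_dx /mono !exprD; ring. Qed.

Lemma mono_dyM k m (z : R * R) : mono_dy k z * mono m z + mono k z * mono_dy m z =
  ((mon_exp k).2 + (mon_exp m).2)%:R *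
  monomial ((mon_exp k).1 + (mon_exp m).1) ((mon_exp k).2 + (mon_exp m).2).-1 z.
Proof.
by rewrite /monomial [RHS]mulrCA -dpow_prod /mono_dy /mono !exprD; ring.
Qed.
End MonoProduct.

(** * Integrals of polynomials over the domain *)

Section Cubature.
Variables (R : realType) (Om : set (R * R)).
Hypotheses (oOm : open Om) (bOm : bounded2 Om).

Lemma indic_monomial_integrable a b :
  (@area R).-integrable setT (EFin \o (fun z => \1_Om z * monomial a b z)).
Proof.
have [B HB] := bOm.
have OmM z : Om z -> `|z.1| < `|B| + 1 /\ `|z.2| < `|B| + 1.
  by move=> /HB[z1 z2]; have := ler_norm B; split; lra.
exact: boxed_integrable (indic_mul_boxed oOm OmM (@monomial_continuous R a b)).
Qed.

Lemma Rintegral_monomialZ a b (k : R) :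
  \int[@area R]_(z in Om) (k * monomial a b z) = k * \int[@area R]_(z in Om) monomial a b z.
Proof.
rewrite [LHS]Rintegral_indic [in RHS]Rintegral_indic -RintegralZl //; last exact: indic_monomial_integrable.
by apply: eq_Rintegral => z _; rewrite mulrCA.
Qed.

Lemma Rintegral_polynomial N (coef : nat -> nat -> R) :
  \int[@area R]_(z in Om) (\sum_(a < N) \sum_(b < N - a) coef a b * (z.1 ^+ a * z.2 ^+ b)) =
  \sum_(a < N) \sum_(b < N - a) coef a b * \int[@area R]_(z in Om) monomial a b z.
Proof.
have im := indic_monomial_integrable.
have icm a b : (@area R).-integrable setT
    (EFin \o (fun z => coef a b * (\1_Om z * monomial a b z))).
  by have := integrableZl measurableT (coef a b) (im a b); apply.
have isum a := Rintegral_sum (index_enum 'I_(N - a)) measurableT (fun b : 'I_(N - a) => icm a b).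
have [_ E] := Rintegral_sum (index_enum 'I_N) measurableT (fun a : 'I_N => (isum a).1).
rewrite Rintegral_indic; transitivity (\int[@area R]_z
    \sum_(a < N) \sum_(b < N - a) coef a b * (\1_Om z * monomial a b z)).
  apply: eq_Rintegral => z _; rewrite mulr_sumr; apply: eq_bigr => a _.
  by rewrite mulr_sumr; apply: eq_bigr => b _; rewrite mulrCA.
rewrite E; apply: eq_bigr => a _; rewrite (isum a).2; apply: eq_bigr => b _.
by rewrite RintegralZl // [in RHS]Rintegral_indic.
Qed.

End Cubature.

(** * Equivalence of cubature rules and operators *)

Section Equivalence.
Variables (R : realType) (Om : set (R * R)) (c : nat) (g : 'I_c -> R -> R * R).
Variables (p n : nat) (S : 'I_n -> R * R).
Hypotheses (oOm : open Om) (bOm : bounded2 Om) (sOm : pw_smooth_boundary Om g).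

Lemma cubature_monomial (w : 'I_n -> R) :
  (forall coef : nat -> nat -> R,
    let f := fun z : R * R => \sum_(a < (2 * p)%N) \sum_(b < (2 * p - a)%N)
                  coef a b * (z.1 ^+ a * z.2 ^+ b) in
    \sum_(i < n) w i * f (S i) = \int[@area R]_(z in Om) f z) ->
  forall a b (k : R), (a + b < 2 * p)%N ->
  \sum_i w i * (k * monomial a b (S i)) = \int[@area R]_(z in Om) (k * monomial a b z).
Proof.
move=> Hw a b k ab.
pose coef a' b' : R := if (a' == a) && (b' == b) then k else 0.
have fE z : \sum_(a' < (2 * p)%N) \sum_(b' < (2 * p - a')%N)
    coef a' b' * (z.1 ^+ a' * z.2 ^+ b') = k * monomial a b z.
  have a2p : (a < 2 * p)%N by lia.
  have b2p : (b < 2 * p - a)%N by lia.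
  rewrite (bigD1 (Ordinal a2p)) //= [X in _ + X]big1 ?addr0 => [|a' a'a].
    rewrite (bigD1 (Ordinal b2p)) //= big1 ?addr0 => [|b' b'b].
      by rewrite /coef !eqxx.
    by rewrite /coef eqxx /= ifF ?mul0r //; apply: negbTE.
  apply: big1 => b' _; rewrite /coef ifF ?mul0r //.
  by apply: negbTE; rewrite negb_and; apply/orP; left.
have := Hw coef; rewrite /= => E.
under eq_bigr do rewrite -fE.
by rewrite E; apply: eq_Rintegral => z _; rewrite fE.
Qed.

Lemma sbp_of_cubature : \rank (vandermonde S p) = etap p -> pos_cubature Om S p ->
  exists Dx Dy : 'M[R]_n, SBP_x S g p Dx /\ SBP_y S g p Dy.
Proof.
move=> rV [w [w0 /cubature_monomial Hw]].
(* [N] is the exponent being differentiated. If [N = 0], the monomial may have degree [2p], beyond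
   the exactness of the rule, but both sides vanish; otherwise the derivative has degree at most
   [2p - 1]. *)
have key N a b : (N + b <= 2 * p)%N -> a = N.-1 ->
    \sum_i w i * (N%:R * monomial a b (S i)) = \int[@area R]_(z in Om) (N%:R * monomial a b z).
  move=> Nb aN; case: N aN Nb => [|N] /= -> Nb; last by apply: Hw.
  rewrite big1 => [|i _]; last by rewrite mul0r mulr0.
  rewrite (eq_Rintegral _ (g := cst 0)) => [|z _]; last by rewrite mul0r.
  by rewrite Rintegral_cst ?mul0r //; exact: open_measurable2.
have key' N a b : (a + N <= 2 * p)%N -> b = N.-1 ->
    \sum_i w i * (N%:R * monomial a b (S i)) = \int[@area R]_(z in Om) (N%:R * monomial a b z).
  move=> Nb aN; case: N aN Nb => [|N] /= -> Nb; last by apply: Hw; rewrite -addnS.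
  rewrite big1 => [|i _]; last by rewrite mul0r mulr0.
  rewrite (eq_Rintegral _ (g := cst 0)) => [|z _]; last by rewrite mul0r.
  by rewrite Rintegral_cst ?mul0r //; exact: open_measurable2.
have [|Dx HDx] := @sbp_op_of_weights R n S (@mono_dx R) (bint_x g) p w w0 rV.
  move=> k m kp mp; rewrite monoM (green_plane oOm bOm sOm _ _).1 -key //.
    by apply: eq_bigr => i _; rewrite mono_dxM.
  by have := mon_exp_le kp; have := mon_exp_le mp; lia.
have [|Dy HDy] := @sbp_op_of_weights R n S (@mono_dy R) (bint_y g) p w w0 rV.
  move=> k m kp mp; rewrite monoM (green_plane oOm bOm sOm _ _).2 -key' //.
    by apply: eq_bigr => i _; rewrite mono_dyM.
  by have := mon_exp_le kp; have := mon_exp_le mp; lia.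
by exists Dx, Dy.
Qed.

Lemma cubature_of_sbp (D : 'M[R]_n) : SBP_x S g p D -> pos_cubature Om S p.
Proof.
move=> /weights_of_sbp_op[w [w0 Hw]].
exists w; split => // coef f.
(* Up to the nonzero factor [a.+1], the monomial is the x-derivative of one of degree at most [2p],
   which splits into two basis monomials. *)
have mon a b : (a + b < 2 * p)%N ->
    \sum_i w i * monomial a b (S i) = \int[@area R]_(z in Om) monomial a b z.
  move=> ab; have [|k [m [kp mp aE bE]]] := @mon_exp_split p a.+1 b; first by lia.
  have := Hw k m kp mp; rewrite monoM aE bE (green_plane oOm bOm sOm _ _).1.
  under eq_bigr do rewrite mono_dxM aE bE /= mulrCA.
  rewrite Rintegral_monomialZ // -mulr_sumr; apply: mulfI.
  by rewrite pnatr_eq0.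
rewrite /f Rintegral_polynomial //.
under eq_bigr do rewrite mulr_sumr.
rewrite exchange_big; apply: eq_bigr => a _.
under eq_bigr do rewrite mulr_sumr.
rewrite exchange_big; apply: eq_bigr => b _.
rewrite -mon; last by have := ltn_ord b; lia.
by rewrite mulr_sumr; apply: eq_bigr => i _; rewrite mulrCA.
Qed.

End Equivalence.

Theorem theorem3p3 (R : realType) (Om : set (R * R)) (c : nat)
    (g : 'I_c -> R -> R * R) (p n : nat) (S : 'I_n -> R * R) :
  open Om -> bounded2 Om -> pw_smooth_boundary Om g ->
  injective S -> (etap p <= n)%N ->
  \rank (vandermonde S p) = etap p ->
  pos_cubature Om S p <->
  (exists Dx Dy : 'M[R]_n, SBP_x S g p Dx /\ SBP_y S g p Dy).
Proof.
move=> oOm bOm sOm _ _ rV; split; first exact: sbp_of_cubature.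
by move=> [Dx [_ [sbpx _]]]; exact: cubature_of_sbp sbpx.
Qed.
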